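(* Let $r\ge2$, $d\ge2$ and $n\ge\binom{r+d}{d}$ be integers. Let $\mathbf{p}=(p_1,\ldots,p_n)\in X_{r,d,n}$ be a point configuration that lies on a unique hypersurface $S\subseteq\mathbb{P}^r$ of degree $d$, and let $\mathbf{q}:=\mathbf{p}\cap S^{\mathrm{sing}}$ be the tuple of those $p_i$ that lie in the singular locus of $S$. If two points in $\mathbf{q}$ coincide, then $\mathbf{p}$ is a singular point of $X_{r,d,n}$. If all the points in $\mathbf{q}$ are distinct, then the following statements are equivalent: (1) $\mathbf{p}$ is a smooth point of $X_{r,d,n}$; (2) $Z_{\mathbf{q}}$ is $d$-normal; (3) $I_{\mathbf{q}}$ is $(d+1)$-regular; (4) $\operatorname{reg} I_{\mathbf{q}}\le d+1$.
   Context: The base field $\Bbbk$ is arbitrary; a point of a scheme means a $\Bbbk$-rational point. $X_{r,d,n}\subseteq(\mathbb{P}^r)^n$ is the closed subscheme parametrizing $n$-tuples of points lying on a common degree $d$ hypersurface, with the scheme structure defined by the vanishing of the maximal minors (of size $\binom{r+d}{d}$) of the $\binom{r+d}{d}\times n$ multi-Veronese matrix, whose $i$-th column is the vector of all degree $d$ monomials in the homogeneous coordinates of the $i$-th point. If $p_{i_1},\ldots,p_{i_k}$ are the entries of $\mathbf{p}$ (with repetition) lying in the singular locus $S^{\mathrm{sing}}$ of $S$, then $\mathbf{q}=(p_{i_1},\ldots,p_{i_k})$. $Z_{\mathbf{q}}$ is the closed reduced subscheme of $\mathbb{P}^r$ supported on the set of points in $\mathbf{q}$, and $I_{\mathbf{q}}$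 denotes its ideal (sheaf). A finite subscheme $\Gamma\subseteq\mathbb{P}^r$ is $d$-normal if the restriction $\mathrm{H}^0(\mathcal{O}_{\mathbb{P}^r}(d))\to\mathrm{H}^0(\mathcal{O}_\Gamma(d))$ is surjective. A coherent sheaf $\mathcal{F}$ on $\mathbb{P}^r$ is $m$-regular ($m\in\mathbb{Z}_{\ge0}$) if $\mathrm{H}^i(\mathcal{F}(m-i))=0$ for all $i>0$, and $\operatorname{reg}\mathcal{F}$ is the least $m$ such that $\mathcal{F}$ is $m$-regular. *)

(* Defs.v *)
From mathcomp Require Export all_boot all_order all_algebra.
From mathcomp.multinomials Require Export mpoly.

Set Implicit Arguments.
Unset Strict Implicit.
Unset Printing Implicit Defensive.

Import GRing.Theory Num.Theory.
Local Open Scope ring_scope.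

Local Notation "x %:F" := (@FracField.tofrac _ x).

(* A k-point of P^r is given by homogeneous coordinates, i.e. by a nonzero
   v : 'rV[K]_r.+1; nonzero u and v are the same point iff they span the same
   line. *)
Definition same_point (K : fieldType) (r : nat) (u v : 'rV[K]_r.+1) : bool :=
  (u == v)%MS.

(** Hypersurfaces *)

(* A degree d hypersurface is the class of a nonzero form F of degree d up to
   scalars. *)
Definition on_unique_hypersurface (K : fieldType) (r d n : nat)
    (p : 'I_n -> 'rV[K]_r.+1) (F : {mpoly K[r.+1]}) : Prop :=
  [/\ F != 0, F \is d.-homog, forall i, F.@[p i 0] = 0
    & forall G : {mpoly K[r.+1]}, G \is d.-homog ->
        (forall i, G.@[p i 0] = 0) -> exists a : K, G = a *: F].

Definition in_sing (K : fieldType) (r : nat) (F : {mpoly K[r.+1]})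
    (v : 'rV[K]_r.+1) : bool :=
  (F.@[v 0] == 0) && [forall j, F^`M(j).@[v 0] == 0].

(* The tuple of those p_i that are singular points of F = 0, in order and with
   repetition. *)
Definition sing_points (K : fieldType) (r n : nat) (p : 'I_n -> 'rV[K]_r.+1)
    (F : {mpoly K[r.+1]}) : seq 'rV[K]_r.+1 :=
  [seq p i | i <- enum 'I_n & in_sing F (p i)].

(** Smooth points of affine schemes of finite type *)

Definition ideal_gen (K : fieldType) (N : nat) (T : finType)
    (g : T -> {mpoly K[N]}) (f : {mpoly K[N]}) : Prop :=
  exists a : T -> {mpoly K[N]}, f = \sum_(t : T) a t * g t.

(* f lies in the extension of the ideal J to the local ring of A^N at x. *)
Definition local_ideal (K : fieldType) (N : nat) (J : {mpoly K[N]} -> Prop)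
    (x : 'I_N -> K) (f : {mpoly K[N]}) : Prop :=
  exists u : {mpoly K[N]}, u.@[x] != 0 /\ J (u * f).

(* The closed subscheme V(g) of A^N is smooth over K at the K-point x (of
   relative dimension N - c): x lies on V(g), and near x the ideal of V(g) is
   generated by some c elements whose differentials are linearly independent
   at x (Bosch-Luetkebohmert-Raynaud, Neron Models, Definition 2.2/3; Mumford,
   Red Book, III.10). The h i are unrelated to the given generators g. *)
Definition smooth_at (K : fieldType) (N : nat) (T : finType)
    (g : T -> {mpoly K[N]}) (x : 'I_N -> K) : Prop :=
  (forall t, (g t).@[x] = 0) /\
  exists (c : nat) (h : 'I_c -> {mpoly K[N]}),
    (forall f, local_ideal (ideal_gen g) x f <-> local_ideal (ideal_gen h) x f)
    /\ row_free (\matrix_(i < c, j < N) (h i)^`M(j).@[x]).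

(** The scheme X_{r,d,n} *)

Definition monomials (r d : nat) : seq 'X_{1..r.+1} :=
  [seq s2m t | t : d.-tuple 'I_r.+1 <- enum (basis r.+1 d)].

Lemma monomials_uniq r d : uniq (monomials r d).
Proof. exact: uniq_basis. Qed.

Lemma mem_monomials r d m : (m \in monomials r d) = (mdeg m == d).
Proof. by rewrite basis_cover. Qed.

Lemma size_monomials r d : size (monomials r d) = 'C(r + d, d).
Proof. by rewrite addnC size_basis. Qed.

(* Over an arbitrary commutative ring, so as to apply both to points and to
   the generic configuration in an affine chart. *)
Definition veronese (R : comNzRingType) (r d n : nat)
    (x : 'I_n -> 'I_r.+1 -> R) : 'M[R]_('C(r + d, d), n) :=
  \matrix_(a, i) mmap1 (x i) (nth 0%MM (monomials r d) a).

(* The maximal minors. Letting f range over all maps, rather than over the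
   increasing ones, only adds zeros and repetitions up to sign. *)
Definition max_minor (R : comNzRingType) (r d n : nat)
    (x : 'I_n -> 'I_r.+1 -> R) (f : {ffun 'I_('C(r + d, d)) -> 'I_n}) : R :=
  \det (colsub f (veronese d x)).

Definition in_X (K : fieldType) (r d n : nat) (p : 'I_n -> 'rV[K]_r.+1) :
    Prop :=
  forall f, max_minor (d := d) (fun i => p i 0) f = 0.

(* For c : 'I_n -> 'I_r.+1, the standard open subset of (P^r)^n where the
   c_i-th homogeneous coordinate of the i-th point is invertible is an affine
   space with n * r coordinates, the (i, l)-th one being the ratio of the
   homogeneous coordinates of index lift (c i) l and c i of the i-th point. *)
Definition chart_generic (K : fieldType) (r n : nat) (c : 'I_n -> 'I_r.+1)
    (i : 'I_n) (j : 'I_r.+1) : {mpoly K[n * r]} :=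
  if unlift (c i) j is Some l then 'X_(mxvec_index i l) else 1.

Definition chart_coord (K : fieldType) (r n : nat) (c : 'I_n -> 'I_r.+1)
    (p : 'I_n -> 'rV[K]_r.+1) : 'I_(n * r) -> K :=
  mxvec (\matrix_(i < n, l < r) (p i 0 (lift (c i) l) / p i 0 (c i))) 0.

Definition smooth_point_X (K : fieldType) (r d n : nat)
    (p : 'I_n -> 'rV[K]_r.+1) : Prop :=
  exists c : 'I_n -> 'I_r.+1,
    (forall i, p i 0 (c i) != 0) /\
    smooth_at (max_minor (d := d) (chart_generic K c)) (chart_coord c p).

Definition singular_point_X (K : fieldType) (r d n : nat)
    (p : 'I_n -> 'rV[K]_r.+1) : Prop :=
  in_X d p /\ ~ smooth_point_X d p.

(** Ideal sheaves on P^r and their cohomology *)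

(* The saturated homogeneous ideal of the reduced subscheme of P^r supported on
   the points of q. *)
Definition vanishing_ideal (K : fieldType) (r : nat)
    (q : seq 'rV[K]_r.+1) (f : {mpoly K[r.+1]}) : Prop :=
  forall v, v \in q -> forall k, (pihomog mdeg k f).@[v 0] = 0.

Definition unit_ideal (K : fieldType) (r : nat) (f : {mpoly K[r.+1]}) : Prop :=
  True.

(* For a homogeneous ideal J with associated ideal sheaf J~, the sections of
   the twist J~(m) over the open set of P^r where the coordinates x_j, j \in s,
   are all nonzero: the degree m part of the localization of J at the product
   of these x_j, inside the fraction field of K[x_0, ..., x_r]. *)
Definition twist_section (K : fieldType) (r : nat)
    (J : {mpoly K[r.+1]} -> Prop) (m : int) (s : {set 'I_r.+1})
    (u : {fraction {mpoly K[r.+1]}}) : Prop :=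
  exists (e k : nat) (f : {mpoly K[r.+1]}),
    [/\ J f, f \is k.-homog, k%:Z = m + (e * #|s|)%N%:Z
      & u = f%:F / (\prod_(j in s) 'X_j)%:F ^+ e].

(* Alternating Cech i-cochains for the standard affine cover of P^r: an index
   j_0 < ... < j_i is encoded as the set of its i.+1 elements. *)
Definition cech_cochain (K : fieldType) (r : nat)
    (J : {mpoly K[r.+1]} -> Prop) (m : int) (i : nat)
    (a : {set 'I_r.+1} -> {fraction {mpoly K[r.+1]}}) : Prop :=
  forall s : {set 'I_r.+1}, #|s| = i.+1 -> twist_section J m s (a s).

Definition cech_d (K : fieldType) (r : nat)
    (a : {set 'I_r.+1} -> {fraction {mpoly K[r.+1]}}) (s : {set 'I_r.+1}) :
    {fraction {mpoly K[r.+1]}} :=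
  \sum_(j in s) (-1) ^+ #|[set l in s | (l < j)%N]| * a (s :\ j).

(* H^(i+1)(P^r, J~(m)) = 0, the cohomology of a coherent sheaf being computed
   from the standard affine cover. Only positive degrees occur in the
   definition of regularity. *)
Definition cohomology_vanishesS (K : fieldType) (r : nat)
    (J : {mpoly K[r.+1]} -> Prop) (m : int) (i : nat) : Prop :=
  forall a, cech_cochain J m i.+1 a ->
    (forall s : {set 'I_r.+1}, #|s| = i.+3 -> cech_d a s = 0) ->
  exists2 b, cech_cochain J m i b
    & forall s : {set 'I_r.+1}, #|s| = i.+2 -> a s = cech_d b s.

Definition m_regular (K : fieldType) (r : nat)
    (J : {mpoly K[r.+1]} -> Prop) (m : nat) : Prop :=
  forall i : nat, cohomology_vanishesS J (m%:Z - i.+1%:Z) i.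

Definition is_reg (K : fieldType) (r : nat) (J : {mpoly K[r.+1]} -> Prop)
    (m : nat) : Prop :=
  m_regular J m /\ forall k, m_regular J k -> (m <= k)%N.

Definition reg_le (K : fieldType) (r : nat) (J : {mpoly K[r.+1]} -> Prop)
    (m : nat) : Prop :=
  exists2 k, is_reg J k & (k <= m)%N.

(* Surjectivity of H^0(O_P(d)) -> H^0(O_Gamma(d)), for Gamma the subscheme of
   the homogeneous ideal J. H^0(O_P(d)) is the space of forms of degree d. A
   section of O_Gamma(d) is a family of sections t j of O_P(d) over the sets
   x_j != 0, taken modulo J~(d), that agree on the overlaps modulo J~(d). *)
Definition d_normal (K : fieldType) (r : nat) (J : {mpoly K[r.+1]} -> Prop)
    (d : nat) : Prop :=
  forall t : 'I_r.+1 -> {fraction {mpoly K[r.+1]}},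
    (forall j, twist_section (@unit_ideal K r) d%:Z [set j] (t j)) ->
    (forall i j, twist_section J d%:Z [set i; j] (t i - t j)) ->
  exists2 f : {mpoly K[r.+1]}, f \is d.-homog
    & forall j, twist_section J d%:Z [set j] (f%:F - t j).

(* Main.v *)
From Stdlib Require Import Classical_Prop.
From mathcomp Require Import ring zify.
Require Import Defs.

Set Implicit Arguments.
Unset Strict Implicit.
Unset Printing Implicit Defensive.

Import GRing.Theory.
Local Open Scope ring_scope.
Local Notation "x %:F" := (@FracField.tofrac _ x).

(** Let V be the Veronese matrix of the generic configuration in an affine chart
    and A its value at the given configuration, with entries in K. Since the
    hypersurface is unique, the left kernel of A is the line spanned by the
    coefficients of F. All conditions of the theorem are compared with the
    linear independence of the evaluations of forms of degree d at the singular
    points of F among the points of the configuration, counted with repetition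
    ([sing_evaluations_free]).

    Smoothness. Some minor of A of size one less than maximal is not zero. Fix
    its columns as base columns. Near the configuration the maximal minors are
    generated by the bordered minors h_k, one for each other column k
    ([minor_in_bordered]). Expanding h_k along its border column writes it as
    the value at the point k of a form whose coefficients are cofactors, and
    which specializes to a multiple of F. For a relation w between the columns
    of A this gives, up to a nonzero factor, that the combination of the dh_k
    with coefficients w_k is the sum of the w_i d(F(P_i)), where d(F(P_i))
    vanishes exactly if P_i is a singular point of F. Since these covectors live
    in different coordinates, the dh_k are independent if and only if no nonzero
    relation w is supported on the singular points ([smooth_at_chart]).

    Independence of the dh_k implies smoothness. For the converse one has to
    exclude that X is smooth of larger dimension than its number of equations
    predicts. No dimension theory is used: it suffices that the h_k are minimal
    generators of the local ideal ([smooth_atP]). In a relation between the h_k,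
    let all points but P_k specialize to the given ones. Then only one term is
    left, the coefficient of h_k times a nonzero multiple of the polynomial
    F(P_k), so that this coefficient is zero after specialization; hence all
    coefficients vanish at the configuration.

    Cohomology. If the singular points are distinct, the independence means that
    each of them can be separated from the others by a form of degree d
    ([sing_evaluations_freeP]), whereas forms of large degree always separate
    them. A section of the twisted structure sheaf over a chart belongs to the
    ideal sheaf if and only if its values at the points vanish, and over the
    chart of a nonempty set of coordinates the values are arbitrary. This gives
    the criterion for d-normality ([d_normalP]). For regularity, the Cech
    complex of the structure sheaf is contracted monomial by monomial
    ([cohomology_structure_sheaf]) and that of the values point by point, both
    times by the same cone construction ([cech_coneP]); only for the first
    cohomology does this need separation by forms of the given degree
    ([cohomology_ideal_points]), and conversely its vanishing provides such
    forms ([separated_of_cohomology]). Since separation in some degree implies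
    separation in all larger degrees, the bound on the regularity is equivalent
    to the same condition. *)

(** * Bordered minors *)

Section BorderedMinors.

Variables (R : comNzRingType) (N n : nat).
Implicit Types (M : 'M[R]_(N, n)) (f t : 'I_N -> 'I_n) (a b : 'I_N).

(** The base columns are the [f b'] with [b' != b], and the bordering column is
    placed at position [b]. In this way all indices range over ['I_N], and none
    over a type of one element less. *)
Definition bordered_minor M f b k : R :=
  \det (colsub (fun b' => if b' == b then k else f b') M).

Definition border_cofactor M f b a : R := cofactor (colsub f M) a b.

Lemma bordered_minorE M f b k :
  bordered_minor M f b k = \sum_a M a k * border_cofactor M f b a.
Proof.
rewrite /bordered_minor (expand_det_col _ b); apply: eq_bigr => a _.
rewrite !mxE eqxx; congr (_ * _); rewrite /border_cofactor /cofactor.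
congr (_ * \det _); apply/matrixP => i j; rewrite !mxE.
by rewrite eq_sym (negPf (neq_lift b j)).
Qed.

Lemma bordered_minor_base M f b b' :
  b' != b -> bordered_minor M f b (f b') = 0.
Proof.
move=> nb; rewrite /bordered_minor -det_tr.
apply: (determinant_alternate nb) => a; rewrite !mxE.
by rewrite (negPf nb) eqxx.
Qed.

(** Replacing row [a] of the submatrix with columns [t] by the combination of
    its rows with the border cofactors as coefficients multiplies the
    determinant by the coefficient of row [a], and turns that row into a row
    of bordered minors. *)
Lemma minor_in_bordered M f b a t : exists e : 'I_N -> R,
  border_cofactor M f b a * \det (colsub t M)
  = \sum_j e j * bordered_minor M f b (t j).
Proof.
pose E : 'M[R]_N := \matrix_(i, i')
  if i == a then border_cofactor M f b i' else (i == i')%:R.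
have detE : \det E = border_cofactor M f b a.
  rewrite (expand_det_col _ a) (bigD1 a) //= big1 => [|i nia]; last first.
    by rewrite !mxE (negPf nia) mul0r.
  rewrite addr0 !mxE eqxx -[RHS]mulr1; congr (_ * _).
  rewrite /cofactor addnn -signr_odd odd_double mul1r -[RHS](det1 _ N.-1).
  congr (\det _); apply/matrixP => i j; rewrite !mxE.
  by rewrite eq_sym (negPf (neq_lift _ _)) (inj_eq lift_inj).
exists (fun j => cofactor (E *m colsub t M) a j).
rewrite -detE -det_mulmx (expand_det_row _ a); apply: eq_bigr => j _.
rewrite mulrC; congr (_ * _); rewrite mxE bordered_minorE.
by apply: eq_bigr => i _; rewrite !mxE eqxx mulrC.
Qed.

(** The relation is column [a] of the adjugate of the bordered matrix. Its
    coefficient at the border does not involve the border column [k]. *)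
Lemma bordered_minor_relation M f b a k : bordered_minor M f b k = 0 ->
  exists w : 'I_N -> R, w b = border_cofactor M f b a /\
    forall i, \sum_b' w b' * M i (if b' == b then k else f b') = 0.
Proof.
move=> h0; pose X := colsub (fun b' => if b' == b then k else f b') M.
exists (fun b' => cofactor X a b'); split.
  rewrite /border_cofactor /cofactor; congr (_ * \det _).
  apply/matrixP => i j; rewrite !mxE.
  by rewrite eq_sym (negPf (neq_lift b j)).
move=> i; have /matrixP/(_ i a) := mul_mx_adj X.
rewrite [\det X]h0 raddf0 [in RHS]mxE mxE => e; rewrite -[RHS]e.
by apply: eq_bigr => j _; rewrite !mxE mulrC.
Qed.

(** A nonzero border cofactor makes the base columns independent: this is the
    family dual to them, given by the adjugate of the matrix in which column
    [b] is replaced by the unit column [a]. *)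
Lemma border_cofactor_dual M f b a b0 : b0 != b -> exists z : 'I_N -> R,
  forall b', b' != b ->
    \sum_i z i * M i (f b') = border_cofactor M f b a *+ (b0 == b').
Proof.
move=> nb0; pose X : 'M[R]_N :=
  \matrix_(i, b') if b' == b then (i == a)%:R else M i (f b').
have detX : \det X = border_cofactor M f b a.
  rewrite (expand_det_col _ b) (bigD1 a) //= !mxE !eqxx mul1r big1.
    rewrite addr0 /border_cofactor /cofactor; congr (_ * \det _).
    apply/matrixP => i j; rewrite !mxE.
    by rewrite eq_sym (negPf (neq_lift b j)).
  by move=> i nia; rewrite !mxE eqxx (negPf nia) mul0r.
exists (fun i => (\adj X) b0 i) => b' nb'.
have := mul_adj_mx X; move/matrixP/(_ b0 b'); rewrite mxE [RHS]mxE -detX => <-.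
by apply: eq_bigr => i _; rewrite [X i b']mxE (negPf nb').
Qed.

End BorderedMinors.

Lemma border_cofactor_map (R S : comNzRingType) (phi : {rmorphism R -> S}) N n
    (M : 'M[R]_(N, n)) f b a :
  border_cofactor (map_mx phi M) f b a = phi (border_cofactor M f b a).
Proof. by rewrite /border_cofactor -map_mxsub cofactor_map_mx. Qed.

(** If the vectors of the left kernel of a matrix with vanishing maximal minors
    are determined by their coordinate [a], then enlarging the matrix by the
    unit column [a] makes its rows independent, and a nonzero maximal minor of
    the enlarged matrix has to use that column. *)
Lemma border_cofactor_neq0 (K : fieldType) N n (A : 'M[K]_(N, n)) (a : 'I_N)
    (i0 : 'I_n) :
  (forall f : 'I_N -> 'I_n, \det (colsub f A) = 0) ->
  (forall v : 'rV[K]_N, v *m A = 0 -> v 0 a = 0 -> v = 0) ->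
  exists f b, border_cofactor A f b a != 0.
Proof.
move=> A0 kerA; pose B := row_mx A (delta_mx a (0 : 'I_1)).
have fullB : row_full B^T.
  rewrite /row_full mxrank_tr -/(row_free B); apply: inj_row_free => v.
  rewrite mul_mx_row -[RHS]row_mx0 => /eq_row_mx[vA].
  rewrite -colE => /matrixP/(_ 0 0); rewrite !mxE; exact: kerA.
pose g : 'I_N -> 'I_(n + 1) := fullrankfun fullB.
have detg : \det (colsub g B) != 0.
  by rewrite -det_tr trmx_mxsub -unitfE -unitmxE; apply: fullrowsub_unit.
pose f b := if split (g b) is inl i then i else i0.
have gf b : g b != rshift n 0 -> g b = lshift 1 (f b).
  rewrite /f; case: splitP => [j e _|j e]; first exact: val_inj.
  by rewrite -val_eqE /= e ord1 /= eqxx.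
case: (pickP [pred b | g b == rshift n 0]) => [b /= /eqP gb|nog]; last first.
  case/eqP: detg; rewrite -[RHS](A0 f); congr (\det _).
  apply/matrixP => i j; rewrite [LHS]mxE gf ?(negbT (nog j)) // /B row_mxEl.
  by rewrite mxE.
have gf' b' : b' != b -> g b' = lshift 1 (f b').
  move=> nb; apply: gf; apply: contra nb => /eqP e.
  by apply/eqP; apply: (@fullrankfun_inj _ _ _ _ fullB); rewrite -/(g _) e -gb.
have cofE : cofactor (colsub g B) a b = border_cofactor A f b a.
  rewrite /border_cofactor /cofactor; congr (_ * \det _).
  apply/matrixP => i j; rewrite !mxE gf' 1?eq_sym ?neq_lift //.
  by rewrite -[lshift 1 _]/(unsplit (inl _)) unsplitK.
exists f, b; apply: contra detg => /eqP c0; apply/eqP.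
rewrite (expand_det_col _ b) (bigD1 a) //= cofE c0 mulr0 add0r.
rewrite big1 // => i nia.
by rewrite mxE gb /B row_mxEr mxE (negPf nia) mul0r.
Qed.

(** * Forms and their values *)

Lemma mpoly_ring_ind (R : comNzRingType) (k : nat) (P : {mpoly R[k]} -> Prop) :
  (forall c, P c%:MP) -> (forall i, P 'X_i) ->
  (forall f g, P f -> P g -> P (f + g)) ->
  (forall f g, P f -> P g -> P (f * g)) -> forall f, P f.
Proof.
move=> PC PX PD PM f; have P1 : P 1 by rewrite -mpolyC1.
rewrite [f]mpolyE; apply: big_ind => [||m _]; first by rewrite -(mpolyC0 k).
  exact: PD.
rewrite -mul_mpolyC; apply: (PM) => //; rewrite mpolyXE_id.
apply: big_ind => [||i _]; [exact: P1 | exact: PM |].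
by elim: (m i) => [|e IH]; rewrite ?expr0 // exprS; apply: PM.
Qed.

Lemma mderivXU (R : nzRingType) (k : nat) (i j : 'I_k) :
  ('X_i : {mpoly R[k]})^`M(j) = (i == j)%:R.
Proof.
rewrite mderivX mnm1E; case: eqP => [->|_]; last by rewrite scale0r.
have -> : (U_(j) - U_(j) = 0)%MM by apply/mnmP => l; rewrite mnmBE subnn mnm0E.
by rewrite scale1r mpolyX0.
Qed.

Lemma mderiv_mmap (R : comNzRingType) (k l : nat) (h : 'I_k -> {mpoly R[l]})
    (f : {mpoly R[k]}) (j : 'I_l) :
  (mmap (@mpolyC l R) h f)^`M(j)
  = \sum_i mmap (@mpolyC l R) h f^`M(i) * (h i)^`M(j).
Proof.
elim/mpoly_ring_ind: f => [c|i|f g IHf IHg|f g IHf IHg].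
- by rewrite mmapC mderivC big1 // => i _; rewrite mderivC mmap0 mul0r.
- rewrite mmapX mmap1U (bigD1 i) //= big1 => [|i' ni].
    by rewrite mderivXU eqxx rmorph1 mul1r addr0.
  by rewrite mderivXU eq_sym (negPf ni) rmorph0 mul0r.
- rewrite mmapD mderivD IHf IHg -big_split /=; apply: eq_bigr => i _.
  by rewrite mderivD mmapD mulrDl.
- rewrite rmorphM /= mderivM IHf IHg mulr_suml mulr_sumr -big_split /=.
  apply: eq_bigr => i _; rewrite mderivM rmorphD !rmorphM /= mulrDl.
  by rewrite mulrAC mulrA.
Qed.

Lemma meval_mmap (R : comNzRingType) (k l : nat) (h : 'I_k -> {mpoly R[l]})
    (f : {mpoly R[k]}) (v : 'I_l -> R) :
  (mmap (@mpolyC l R) h f).@[v] = f.@[fun i => (h i).@[v]].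
Proof.
elim/mpoly_ring_ind: f => [c0|i|f g IHf IHg|f g IHf IHg].
- by rewrite mmapC !mevalC.
- by rewrite mmapX mmap1U mevalXU.
- by rewrite mmapD !mevalD IHf IHg.
- by rewrite rmorphM !mevalM IHf IHg.
Qed.

Lemma dhomog_mderiv (R : nzRingType) (k d : nat) (f : {mpoly R[k]}) (j : 'I_k) :
  f \is d.-homog -> f^`M(j) \is d.-1.-homog.
Proof.
move=> /dhomogP df; apply/dhomogP => m.
rewrite mcoeff_msupp mcoeff_mderiv => nz.
have /df : (m + U_(j))%MM \in msupp f.
  by rewrite mcoeff_msupp; apply: contraNneq nz => ->; rewrite mul0rn.
by move=> <- /=; rewrite mdegD mdeg1 addn1.
Qed.

Lemma meval_dhomog_scale (R : comNzRingType) (k d : nat) (f : {mpoly R[k]})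
    (a : R) (v : 'I_k -> R) :
  f \is d.-homog -> f.@[fun j => a * v j] = a ^+ d * f.@[v].
Proof.
move=> /dhomogP df; rewrite !mevalE mulr_sumr !big_seq.
apply: eq_bigr => m /df <- /=; rewrite mulrCA; congr (_ * _).
by rewrite /= mdegE -prodrXr -big_split; apply: eq_bigr => i _; rewrite exprMn.
Qed.

Section Veronese.

Variables (K : fieldType) (r d n : nat).

Definition monomial (a : 'I_('C(r + d, d))) := nth 0%MM (monomials r d) a.

Lemma monomial_inj : injective monomial.
Proof.
move=> a b /eqP; rewrite nth_uniq ?monomials_uniq ?size_monomials //.
by move=> /eqP /val_inj.
Qed.

Lemma mdeg_monomial a : mdeg (monomial a) = d.
Proof. by apply/eqP; rewrite -mem_monomials mem_nth ?size_monomials. Qed.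

Lemma dhomog_sum_monomials (f : {mpoly K[r.+1]}) :
  f \is d.-homog -> f = \sum_a f@_(monomial a) *: 'X_[monomial a].
Proof.
move=> df; apply/mpolyP => m; rewrite raddf_sum /=.
have [dm|dm] := eqVneq (mdeg m) d; last first.
  rewrite (dhomog_nemf_coeff df) // big1 // => a _.
  rewrite mcoeffZ mcoeffX; case: eqP => [e|]; last by rewrite mulr0.
  by rewrite -e mdeg_monomial eqxx in dm.
have ma : (index m (monomials r d) < 'C(r + d, d))%N.
  by rewrite -size_monomials index_mem mem_monomials dm.
have mE : monomial (Ordinal ma) = m.
  by rewrite /monomial nth_index // mem_monomials dm.
rewrite (bigD1 (Ordinal ma)) //= mE mcoeffZ mcoeffX eqxx mulr1.
rewrite big1 ?addr0 // => a na; rewrite mcoeffZ mcoeffX.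
case: eqP => [e|]; last by rewrite mulr0.
by case/eqP: na; apply: monomial_inj; rewrite mE.
Qed.

Definition form_of (u : 'I_('C(r + d, d)) -> K) : {mpoly K[r.+1]} :=
  \sum_a u a *: 'X_[monomial a].

Lemma form_of_dhomog u : form_of u \is d.-homog.
Proof.
by apply: rpred_sum => a _; rewrite rpredZ // dhomogX /= mdeg_monomial.
Qed.

Lemma coef_form_of u a : (form_of u)@_(monomial a) = u a.
Proof.
rewrite raddf_sum (bigD1 a) //= mcoeffZ mcoeffX eqxx mulr1 big1 ?addr0 // => b.
by rewrite mcoeffZ mcoeffX (inj_eq monomial_inj) => /negPf ->; rewrite mulr0.
Qed.

Lemma mmap_veronese (S : comNzRingType) (phi : {rmorphism K -> S})
    (x : 'I_n -> 'I_r.+1 -> S) (f : {mpoly K[r.+1]}) i : f \is d.-homog ->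
  mmap phi (x i) f = \sum_a phi f@_(monomial a) * veronese d x a i.
Proof.
move=> /dhomog_sum_monomials {1}->; rewrite raddf_sum /=.
by apply: eq_bigr => a _; rewrite mmapZ mmapX mxE.
Qed.

Lemma meval_veronese (x : 'I_n -> 'I_r.+1 -> K) (f : {mpoly K[r.+1]}) i :
  f \is d.-homog -> f.@[x i] = \sum_a f@_(monomial a) * veronese d x a i.
Proof. exact: (mmap_veronese idfun). Qed.

End Veronese.

Lemma map_veronese (R S : comNzRingType) (phi : {rmorphism R -> S}) r d n
    (x : 'I_n -> 'I_r.+1 -> R) :
  map_mx phi (veronese d x) = veronese d (fun i j => phi (x i j)).
Proof.
apply/matrixP => a i; rewrite !mxE /mmap1 rmorph_prod.
by apply: eq_bigr => j _; rewrite rmorphXn.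
Qed.

(** * The Jacobian criterion without dimension theory *)

Section JacobianCriterion.

Variables (K : fieldType) (N : nat) (x : 'I_N -> K).

Lemma ideal_gen_mem (T : finType) (g : T -> {mpoly K[N]}) t : ideal_gen g (g t).
Proof.
exists (fun t' => (t' == t)%:R); rewrite (bigD1 t) //= eqxx mul1r.
by rewrite big1 ?addr0 // => t' /negPf ->; rewrite mul0r.
Qed.

Lemma ideal_gen_sum (T : finType) (g : T -> {mpoly K[N]}) (I : finType)
    (e f : I -> {mpoly K[N]}) :
  (forall i, ideal_gen g (f i)) -> ideal_gen g (\sum_i e i * f i).
Proof.
move=> /fin_all_exists[a fE]; exists (fun t => \sum_i e i * a i t).
under [RHS]eq_bigr do rewrite mulr_suml.
rewrite exchange_big; apply: eq_bigr => i _ /=.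
by rewrite fE mulr_sumr; apply: eq_bigr => t _; rewrite mulrA.
Qed.

Lemma local_ideal_mem (J : {mpoly K[N]} -> Prop) f : J f -> local_ideal J x f.
Proof. by move=> Jf; exists 1; rewrite meval1 oner_eq0 mul1r. Qed.

Lemma local_ideal_vanish (T : finType) (g : T -> {mpoly K[N]}) f :
  (forall t, (g t).@[x] = 0) -> local_ideal (ideal_gen g) x f -> f.@[x] = 0.
Proof.
move=> g0 [u [ux [a /(congr1 (meval x))]]]; rewrite mevalM raddf_sum /=.
rewrite big1 => [/eqP|t _]; last by rewrite mevalM g0 mulr0.
by rewrite mulf_eq0 (negPf ux) => /eqP.
Qed.

Lemma local_ideal_trans (T T' : finType) (g : T -> {mpoly K[N]})
    (g' : T' -> {mpoly K[N]}) f :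
  (forall t, local_ideal (ideal_gen g') x (g t)) ->
  local_ideal (ideal_gen g) x f -> local_ideal (ideal_gen g') x f.
Proof.
move=> gg' [u [ux [a fE]]].
have [v vP] := fin_all_exists gg'.
have [b bP] := fin_all_exists (fun t => (vP t).2).
exists (u * \prod_t v t); split.
  rewrite mevalM mulf_neq0 // rmorph_prod; apply/prodf_neq0 => t _.
  exact: (vP t).1.
exists (fun t' => \sum_t a t * (\prod_(s | s != t) v s) * b t t').
rewrite mulrAC fE mulr_suml.
under [RHS]eq_bigr do rewrite mulr_suml.
rewrite exchange_big /=; apply: eq_bigr => t _.
rewrite (bigD1 t) //=; set P := \prod_(s | _) _.
transitivity (a t * P * (v t * g t)); first by ring.
by rewrite bP mulr_sumr; apply: eq_bigr => t' _; rewrite !mulrA.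
Qed.

Lemma local_ideal_jacobian (T : finType) (g : T -> {mpoly K[N]}) u f
    (a : T -> {mpoly K[N]}) j :
  (forall t, (g t).@[x] = 0) -> f.@[x] = 0 -> u * f = \sum_t a t * g t ->
  u.@[x] * f^`M(j).@[x] = \sum_t (a t).@[x] * (g t)^`M(j).@[x].
Proof.
move=> g0 f0 ufE; transitivity ((u * f)^`M(j).@[x]).
  by rewrite mderivM mevalD !mevalM f0 mulr0 add0r.
rewrite ufE (raddf_sum (mderiv j)) (raddf_sum (meval x)) /=.
apply: eq_bigr => t _.
by rewrite mderivM mevalD !mevalM g0 mulr0 add0r.
Qed.

(** If [h] generates the ideal locally at [x] and every relation between the
    [h k] has coefficients vanishing at [x], that is if [h] is a minimal set of
    generators of the local ideal, then no other system of generators than [h]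
    has to be tested.  Indeed, express the [h k] by generators [h'] with
    independent differentials: a linear relation between the rows of the
    transition matrix at [x] would, after writing the [h'] back in terms of the
    [h k], become a relation between the [h k] with coefficients not all zero
    at [x]. Hence the transition matrix at [x] has independent rows, and it
    expresses the differentials of the [h k] by those of the [h']. *)
Lemma smooth_atP (T : finType) (g : T -> {mpoly K[N]}) (c : nat)
    (h : 'I_c -> {mpoly K[N]}) :
  (forall t, (g t).@[x] = 0) ->
  (forall f, local_ideal (ideal_gen g) x f <-> local_ideal (ideal_gen h) x f) ->
  (forall a, \sum_k a k * h k = 0 -> forall k, (a k).@[x] = 0) ->
  smooth_at g x <-> row_free (\matrix_(k < c, j < N) (h k)^`M(j).@[x]).
Proof.
move=> g0 gh hmin; split=> [[_ [c' [h' [gh' free']]]]|free]; last first.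
  by split=> //; exists c, h.
have h0 k : (h k).@[x] = 0.
  apply: (local_ideal_vanish g0); apply/gh.
  by apply: local_ideal_mem; apply: ideal_gen_mem.
have h'0 k : (h' k).@[x] = 0.
  apply: (local_ideal_vanish g0); apply/gh'.
  by apply: local_ideal_mem; apply: ideal_gen_mem.
have hh' k : local_ideal (ideal_gen h') x (h k).
  by apply/gh'/gh; apply: local_ideal_mem; apply: ideal_gen_mem.
have h'h k : local_ideal (ideal_gen h) x (h' k).
  by apply/gh/gh'; apply: local_ideal_mem; apply: ideal_gen_mem.
have [u uP] := fin_all_exists hh'.
have [A AP] := fin_all_exists (fun k => (uP k).2).
have [u' u'P] := fin_all_exists h'h.
have [B BP] := fin_all_exists (fun k => (u'P k).2).
apply: inj_row_free => v vJ.
(* [y] is [v] in terms of the multiples [u k * h k], which are the combinations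
   of the [h'] *)
pose y k := v 0 k / (u k).@[x].
have yu k : y k * (u k).@[x] = v 0 k by rewrite divfK // (uP k).1.
pose gam j := \sum_k y k *: A k j.
have gam0 j : (gam j).@[x] = 0.
  have e0 : \row_j (gam j).@[x] *m
      \matrix_(k < c', j < N) (h' k)^`M(j).@[x] = 0.
    rewrite -[RHS]vJ; apply/rowP => l; rewrite !mxE.
    under [RHS]eq_bigr do rewrite mxE -yu -mulrA
      (local_ideal_jacobian l h'0 (h0 _) (AP _)) mulr_sumr.
    rewrite exchange_big /=; apply: eq_bigr => k' _.
    rewrite !mxE raddf_sum mulr_suml; apply: eq_bigr => k _ /=.
    by rewrite mevalZ mulrA.
  have /rowP/(_ j) := row_free_inj free' (etrans e0 (esym (mul0mx _ _))).
  by rewrite !mxE.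
pose W := \prod_j u' j.
have Wx : W.@[x] != 0.
  by rewrite rmorph_prod; apply/prodf_neq0 => j _; apply: (u'P j).1.
pose Wj j := \prod_(j' | j' != j) u' j'.
(* the combination of the [h k] with coefficients [W * y k * u k] is the
   combination of the [h' j] with coefficients [W * gam j]; [a] is what remains
   after writing the latter in terms of the [h k] again *)
pose a k := W * (y k *: u k) - \sum_j gam j * Wj j * B j k.
have /hmin a0 : \sum_k a k * h k = 0.
  rewrite /a; under eq_bigr do rewrite mulrBl.
  rewrite sumrB; apply/eqP; rewrite subr_eq0; apply/eqP.
  under eq_bigr do rewrite -mulrA -scalerAl AP.
  under [RHS]eq_bigr do rewrite mulr_suml.
  rewrite [RHS]exchange_big /=.
  transitivity (\sum_j gam j * (W * h' j)); last first.
    apply: eq_bigr => j _; rewrite /W (bigD1 j) //= -/(Wj j).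
    rewrite [u' j * _]mulrC -[_ * u' j * _]mulrA (BP j) !mulr_sumr.
    by apply: eq_bigr => k _; rewrite !mulrA.
  under [RHS]eq_bigr do rewrite mulr_suml.
  rewrite [RHS]exchange_big /=; apply: eq_bigr => k _.
  rewrite scaler_sumr mulr_sumr; apply: eq_bigr => j _.
  by rewrite -scalerAl -!scalerAr mulrCA.
apply/rowP => k; rewrite mxE.
have /eqP := a0 k; rewrite mevalB mevalM mevalZ yu (raddf_sum (meval x)) /=.
rewrite big1 ?subr0 => [|j _]; last by rewrite !mevalM gam0 !mul0r.
by rewrite mulf_eq0 (negPf Wx) => /eqP.
Qed.

End JacobianCriterion.

(** * Smoothness of X at a configuration *)

Lemma euler_dhomog (R : comNzRingType) (k d : nat) (f : {mpoly R[k]}) :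
  f \is d.-homog -> \sum_j 'X_j * f^`M(j) = f *+ d.
Proof.
move=> /dhomogP df; rewrite {2}[f]mpolyE -sumrMnl.
under eq_bigr do rewrite {1}[f]mpolyE (raddf_sum (mderiv _)) mulr_sumr.
rewrite exchange_big !big_seq /=; apply: eq_bigr => m /df /= <-.
rewrite mdegE -sumrMnr; apply: eq_bigr => j _.
rewrite mderivZ mderivX scalerA -scalerAr -mpolyXD.
have [->|mj] := eqVneq (m j) 0%N; first by rewrite mulr0 scale0r.
rewrite addmC submK ?lep1mP //.
by rewrite -scaler_nat scalerA mulrC.
Qed.

(** The evaluations are a family indexed by [i] and not by the points, so that
    their independence fails if two singular points coincide. *)
Definition sing_evaluations_free (K : fieldType) (r d n : nat)
    (p : 'I_n -> 'rV[K]_r.+1) (F : {mpoly K[r.+1]}) : Prop :=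
  forall w : 'I_n -> K,
    (forall i, ~~ in_sing F (p i) -> w i = 0) ->
    (forall G, G \is d.-homog -> \sum_i w i * G.@[p i 0] = 0) ->
  forall i, w i = 0.

Section Chart.

Variables (K : fieldType) (r d n : nat) (p : 'I_n -> 'rV[K]_r.+1).
Variables (F : {mpoly K[r.+1]}) (c : 'I_n -> 'I_r.+1).
Hypotheses (n_ge : ('C(r + d, d) <= n)%N) (pF : on_unique_hypersurface d p F).
Hypothesis pc : forall i, p i 0 (c i) != 0.

Local Notation N := 'C(r + d, d).
Local Notation R := {mpoly K[n * r]}.
Local Notation x := (chart_coord c p).
Local Notation P := (chart_generic K c).
Local Notation V := (veronese d P).

Let nu i j : K := (P i j).@[x].

Let F_hom : F \is d.-homog. Proof. by case: pF. Qed.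

Lemma meval_chart_generic i j : nu i j = (p i 0 (c i))^-1 * p i 0 j.
Proof.
rewrite /nu /chart_generic; case: unliftP => [l ->|->].
  by rewrite mevalXU /chart_coord mxvecE mxE mulrC.
by rewrite meval1 mulVf.
Qed.

Lemma meval_chart_dhomog e G i : G \is e.-homog ->
  G.@[nu i] = (p i 0 (c i))^-1 ^+ e * G.@[p i 0].
Proof.
by move=> /meval_dhomog_scale <-; apply/meval_eq/meval_chart_generic.
Qed.

Let scale_neq0 e i : (p i 0 (c i))^-1 ^+ e != 0.
Proof. by rewrite expf_neq0 ?invr_eq0. Qed.

Lemma meval_chart_eq0 e G i : G \is e.-homog ->
  (G.@[nu i] == 0) = (G.@[p i 0] == 0).
Proof.
by move/meval_chart_dhomog->; rewrite mulf_eq0 (negPf (scale_neq0 _ _)).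
Qed.

Let A : 'M[K]_(N, n) := veronese d nu.

Let mapV : map_mx (meval x) V = A. Proof. exact: map_veronese. Qed.

Let VA a i : (V a i).@[x] = A a i. Proof. by rewrite -mapV [RHS]mxE. Qed.

Let FA i : \sum_a F@_(monomial a) * A a i = 0.
Proof.
rewrite -meval_veronese //; apply/eqP; rewrite (meval_chart_eq0 _ F_hom).
by case: pF => _ _ ->.
Qed.

Let kerA (v : 'I_N -> K) : (forall i, \sum_a v a * A a i = 0) ->
  exists t, forall a, v a = t * F@_(monomial a).
Proof.
move=> vA; have [_ _ _ uniqF] := pF.
have [|t e] := uniqF _ (form_of_dhomog v).
  move=> i; apply/eqP; rewrite -(meval_chart_eq0 _ (form_of_dhomog v)).
  rewrite (meval_veronese _ _ (form_of_dhomog v)).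
  by under eq_bigr do rewrite coef_form_of; rewrite vA.
by exists t => a; rewrite -(coef_form_of v) e mcoeffZ.
Qed.

Let F_coef : exists a, F@_(monomial (r := r) (d := d) a) != 0.
Proof.
case: (pickP [pred a | F@_(monomial (r := r) (d := d) a) != 0]) => [a|e].
  by exists a.
case: pF => /eqP[]; rewrite (dhomog_sum_monomials F_hom) big1 // => a _.
by rewrite (eqP (negbFE (e a))) scale0r.
Qed.

Let minorA f : \det (colsub f A) = 0.
Proof.
apply/eqP/det0P; exists (\row_a F@_(monomial a)).
  have [a Fa] := F_coef; apply: contraNneq Fa => /rowP/(_ a).
  by rewrite !mxE => ->.
apply/rowP => i; rewrite !mxE -[RHS](FA (f i)).
by apply: eq_bigr => a _; rewrite !mxE.
Qed.

(** The covector d(F(P i)) at the configuration. *)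
Let dF i j : K := (mmap (@mpolyC _ K) (P i) F)^`M(j).@[x].

Let dFE i j : dF i j = \sum_l F^`M(l).@[nu i] * (P i l)^`M(j).@[x].
Proof.
rewrite /dF mderiv_mmap (raddf_sum (meval x)); apply: eq_bigr => l _ /=.
by rewrite mevalM meval_mmap.
Qed.

Let dF_lift i i' l : dF i (mxvec_index i' l) =
  if i == i' then F^`M(lift (c i) l).@[nu i] else 0.
Proof.
have inj_index (i1 i2 : 'I_n) (l1 l2 : 'I_r) :
    (mxvec_index i1 l1 == mxvec_index i2 l2) = (i1 == i2) && (l1 == l2).
  by rewrite /mxvec_index (inj_eq (@cast_ord_inj _ _ _)) (inj_eq enum_rank_inj).
rewrite dFE (bigD1 (lift (c i) l)) //= big1 ?addr0.
  rewrite /chart_generic liftK mderivXU inj_index eqxx andbT.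
  by case: (i == i'); rewrite ?meval1 ?mulr1 // meval0 mulr0.
move=> l' nl; rewrite /chart_generic; case: unliftP nl => [l'' ->|_ _].
  rewrite (inj_eq lift_inj) mderivXU inj_index => /negPf->.
  by rewrite andbF meval0 mulr0.
by rewrite -mpolyC1 mderivC meval0 mulr0.
Qed.

Let dF_sing i j : in_sing F (p i) -> dF i j = 0.
Proof.
move=> /andP[_ /forallP dF0]; rewrite dFE big1 // => l _.
have /eqP-> : F^`M(l).@[nu i] == 0.
  by rewrite (meval_chart_eq0 _ (dhomog_mderiv _ F_hom)).
by rewrite mul0r.
Qed.

(** Off the hyperplane at infinity of the chart, Euler's relation recovers the
    missing partial derivative from the others. *)
Let sing_dF (w : 'I_n -> K) : (forall j, \sum_i w i * dF i j = 0) ->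
  forall i, ~~ in_sing F (p i) -> w i = 0.
Proof.
move=> w0 i; apply: contraNeq => wi.
have Fp : F.@[nu i] = 0.
  by apply/eqP; rewrite (meval_chart_eq0 _ F_hom); case: pF => _ _ ->.
have dl l : F^`M(lift (c i) l).@[nu i] = 0.
  have /eqP := w0 (mxvec_index i l); rewrite (bigD1 i) //= dF_lift eqxx.
  rewrite big1 ?addr0 => [|i' /negPf ni]; last by rewrite dF_lift ni mulr0.
  by rewrite mulf_eq0 (negPf wi) => /eqP.
have dc : F^`M(c i).@[nu i] = 0.
  have := congr1 (meval (nu i)) (euler_dhomog F_hom).
  rewrite mevalMn Fp mul0rn (raddf_sum (meval _)) /= (bigD1 (c i)) //= big1.
    rewrite addr0 mevalM mevalXU meval_chart_generic mulVf // mul1r //.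
  move=> j nj; rewrite mevalM; case: (unliftP (c i) j) nj => [l ->|->].
    by rewrite dl mulr0.
  by rewrite eqxx.
rewrite /in_sing -(meval_chart_eq0 _ F_hom) Fp eqxx /=.
apply/forallP => j; rewrite -(meval_chart_eq0 _ (dhomog_mderiv _ F_hom)).
by case: (unliftP (c i) j) => [l|] ->; [rewrite dl eqxx | rewrite dc eqxx].
Qed.

(** Dehomogenizing in the chart of one point is injective on the forms of a
    given degree, since the exponent of the coordinate set to 1 is determined by
    the degree and the other exponents. *)
Let dehomogenize_neq0 i : mmap (@mpolyC _ K) (P i) F != 0.
Proof.
pose del (m : 'X_{1..r.+1}) : 'X_{1..n * r} :=
  [multinom mxvec (\matrix_(i' < n, l < r)
     if i' == i then m (lift (c i) l) else 0%N) ord0 j | j < n * r].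
have delE m l : del m (mxvec_index i l) = m (lift (c i) l).
  by rewrite mnmE mxvecE mxE eqxx.
have PE m : mmap1 (P i) m = 'X_[del m].
  rewrite /mmap1 (bigD1_ord (c i)) //= {1}/chart_generic unlift_none.
  rewrite expr1n mul1r.
  rewrite mpolyXE_id (reindex _ (curry_mxvec_bij _ _)) /=.
  transitivity (\prod_i' \prod_l
      ('X_(mxvec_index i' l) : R) ^+ del m (mxvec_index i' l)); last first.
    by rewrite pair_bigA; apply: eq_bigr => -[].
  rewrite (bigD1 i) //= [X in _ = _ * X]big1 ?mulr1.
    by apply: eq_bigr => l _; rewrite /chart_generic liftK delE.
  move=> i' ni; rewrite big1 // => l _.
  by rewrite mnmE mxvecE mxE (negPf ni) expr0.
have [a0 Fa0] := F_coef; set m0 := monomial a0 in Fa0.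
apply: contraNneq Fa0 => /(congr1 (mcoeff (del m0))); rewrite mcoeff0 => <-.
have suppF0 : F@_m0 = \sum_(m <- msupp F) F@_m * (m == m0)%:R.
  have [m0F|m0F] := boolP (m0 \in msupp F).
    rewrite (bigD1_seq m0) ?msupp_uniq //= eqxx mulr1 big1 ?addr0 //.
    by move=> m /negPf->; rewrite mulr0.
  rewrite (memN_msupp_eq0 m0F) big_seq big1 // => m mF.
  by case: eqP => [e|]; rewrite ?mulr0 //; rewrite e (negPf m0F) in mF.
rewrite suppF0 (raddf_sum (mcoeff (del m0))); apply/eqP; rewrite !big_seq.
apply: eq_bigr => m /(dhomog_mf F_hom) /= dm.
rewrite mul_mpolyC mcoeffZ PE mcoeffX; congr (_ * (nat_of_bool _)%:R).
apply/eqP/eqP => [->//|e].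
have e' l : m (lift (c i) l) = m0 (lift (c i) l) by rewrite -!delE e.
have := dm; rewrite -(mdeg_monomial a0) -/m0 !mdegE.
rewrite (bigD1_ord (c i)) //= [RHS](bigD1_ord (c i)) //=.
under eq_bigr do rewrite e'; move/addIn => ec.
by apply/mnmP => j; case: (unliftP (c i) j) => [l ->|->].
Qed.

Section BorderedGenerators.

Variables (f : 'I_N -> 'I_n) (b a1 : 'I_N).
Hypothesis Ca1 : border_cofactor A f b a1 != 0.

Let h k : R := bordered_minor V f b k.
Let C a : R := border_cofactor V f b a.
Let D := [set k | [forall (b' | b' != b), f b' != k]].

Let CA a : (C a).@[x] = border_cofactor A f b a.
Proof. by rewrite -mapV border_cofactor_map. Qed.

Let hE k : h k = \sum_a V a k * C a. Proof. exact: bordered_minorE. Qed.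

Let h_base k : k \notin D -> h k = 0.
Proof.
rewrite inE negb_forall => /existsP[b']; rewrite negb_imply negbK.
by move=> /andP[nb /eqP <-]; apply: bordered_minor_base.
Qed.

Let base_D b' k : k \in D -> b' != b -> f b' != k.
Proof. by rewrite inE => /forallP/(_ b')/implyP. Qed.

(** The border cofactors are the coefficients of a form that vanishes at all
    points of the configuration. *)
Let cofactor_F : exists2 lam : K, lam != 0 &
  forall a, (C a).@[x] = lam * F@_(monomial a).
Proof.
have [|lam lamE] := kerA (v := fun a => (C a).@[x]).
  move=> i; rewrite -[RHS](minorA (fun b' => if b' == b then i else f b')).
  rewrite -/(bordered_minor A f b i) bordered_minorE.
  by apply: eq_bigr => a _; rewrite CA mulrC.
exists lam => //; apply: contraNneq Ca1 => lam0.
by rewrite -CA lamE lam0 mul0r.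
Qed.

(** A relation [w] between the columns of the Veronese matrix turns the
    variation of the cofactors into zero, so that only the variation of the
    points contributes to the differential of the bordered minors. *)
Let dh_relation lam (w : 'I_n -> K) j :
  (forall a, (C a).@[x] = lam * F@_(monomial a)) ->
  (forall a, \sum_i w i * A a i = 0) ->
  \sum_i w i * (h i)^`M(j).@[x] = lam * \sum_i w i * dF i j.
Proof.
move=> lamE wA.
have dhE i : (h i)^`M(j).@[x] =
    lam * dF i j + \sum_a A a i * (C a)^`M(j).@[x].
  rewrite hE (raddf_sum (mderiv j)) (raddf_sum (meval x)) /=.
  rewrite /dF (mmap_veronese _ P i F_hom) (raddf_sum (mderiv j)).
  rewrite (raddf_sum (meval x)) mulr_sumr -big_split; apply: eq_bigr => a _ /=.
  rewrite mderiv_mulC mderivM mevalD (mevalM _ _ (C a)) (mevalM _ (V a i)).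
  rewrite VA lamE.
  rewrite (mevalM _ _%:MP) mevalC; congr (_ + _).
  by rewrite mulrC -mulrA.
under eq_bigr do rewrite dhE mulrDr.
rewrite big_split /= [X in _ + X](_ : _ = 0) ?addr0.
  by rewrite mulr_sumr; apply: eq_bigr => i _; rewrite mulrCA.
under eq_bigr do rewrite mulr_sumr.
rewrite exchange_big big1 //= => a _.
under eq_bigr do rewrite mulrA.
by rewrite -mulr_suml wA mul0r.
Qed.

(** Specializing all points but [P k0] to the given ones kills all the [h k]
    with [k != k0] and makes [h k0] a nonzero multiple of a dehomogenization of
    [F]. So the coefficient of [h k0] specializes to zero. *)
Let h_minimal (a : 'I_n -> R) :
  \sum_(k in D) a k * h k = 0 -> forall k, k \in D -> (a k).@[x] = 0.
Proof.
move=> rel k0 Dk0; have [lam lam0 lamE] := cofactor_F.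
pose s j : R := mxvec (\matrix_(i < n, l < r)
  if i == k0 then 'X_(mxvec_index i l) else (x (mxvec_index i l))%:MP) 0 j.
pose theta : {rmorphism R -> R} := mmap (@mpolyC _ K) s.
have thetaP i j : theta (P i j) = if i == k0 then P i j else (nu i j)%:MP.
  rewrite /nu /chart_generic; case: unlift => [l|].
    by rewrite /theta /= mmapX mmap1U /s mxvecE mxE mevalXU.
  by rewrite meval1 mpolyC1 if_same rmorph1.
have theta_x g : (theta g).@[x] = g.@[x].
  rewrite /theta /= meval_mmap; apply: meval_eq => j; rewrite /s.
  case/mxvec_indexP: j => i l; rewrite mxvecE mxE.
  by case: (i == k0); rewrite ?mevalXU ?mevalC.
have thetaV a' i : theta (V a' i) = if i == k0 then V a' i else (A a' i)%:MP.
  rewrite !mxE /mmap1 rmorph_prod; case: ifP => ik0.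
    apply: eq_bigr => j _; rewrite rmorphXn; congr (_ ^+ _).
    by rewrite thetaP ik0.
  rewrite rmorph_prod; apply: eq_bigr => j _; rewrite !rmorphXn.
  by congr (_ ^+ _); rewrite thetaP ik0.
have thetaC a' : theta (C a') = (lam * F@_(monomial a'))%:MP.
  rewrite -lamE CA -!border_cofactor_map /border_cofactor /cofactor.
  congr (_ * \det _); apply/matrixP => i j; rewrite !mxE.
  have := thetaV (lift a' i) (f (lift b j)); rewrite !mxE => ->.
  by rewrite (negPf (base_D Dk0 _)) // eq_sym neq_lift.
have theta_h k : k \in D -> theta (h k) = if k == k0 then
    lam%:MP * mmap (@mpolyC _ K) (P k0) F else 0.
  move=> _; rewrite hE rmorph_sum /=.
  under eq_bigr => a' _ do rewrite rmorphM thetaV thetaC.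
  case: eqP => [->|_].
    rewrite (mmap_veronese _ P k0 F_hom) mulr_sumr; apply: eq_bigr => a' _.
    by rewrite mpolyCM mulrC mulrA.
  rewrite -[RHS](mpolyC0 (n * r)) -(mulr0 lam) -(FA k) mulr_sumr.
  rewrite (raddf_sum (@mpolyC _ K)).
  by apply: eq_bigr => a' _; rewrite -mpolyCM; congr _%:MP; ring.
have /eqP := congr1 theta rel; rewrite rmorph_sum rmorph0 /= (bigD1 k0) //=.
rewrite big1 ?addr0 => [|k /andP[Dk /negPf nk]]; last first.
  by rewrite rmorphM theta_h // nk mulr0.
rewrite rmorphM theta_h // eqxx !mulf_eq0 mpolyC_eq0 (negPf lam0) /=.
rewrite (negPf (dehomogenize_neq0 _)) // orbF => /eqP e.
by rewrite -theta_x [theta _]e meval0.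
Qed.

Let hD (k : 'I_#|D|) : R := h (enum_val k).

Let ideal_hD k : ideal_gen hD (h k).
Proof.
have [Dk|/h_base->] := boolP (k \in D).
  by rewrite -(enum_rankK_in Dk Dk); apply: ideal_gen_mem.
by exists (fun=> 0); rewrite big1 // => k' _; rewrite mul0r.
Qed.

Let Jacobian_relation lam (w : 'I_n -> K) :
  (forall a, (C a).@[x] = lam * F@_(monomial a)) ->
  (forall a, \sum_i w i * A a i = 0) ->
  (\row_k w (enum_val k)) *m \matrix_(k < #|D|, j < n * r) (hD k)^`M(j).@[x]
  = \row_j (lam * \sum_i w i * dF i j).
Proof.
move=> lamE wA; apply/rowP => j; rewrite !mxE -(dh_relation _ lamE) //.
rewrite [RHS](bigID (mem D)) /= [X in _ + X]big1 ?addr0; last first.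
  by move=> i /h_base ->; rewrite mderiv0 meval0 mulr0.
by rewrite [RHS]big_enum_val; apply: eq_bigr => k _; rewrite !mxE.
Qed.

Let relation_scale (w : 'I_n -> K) :
  (forall G, G \is d.-homog -> \sum_i w i * G.@[p i 0] = 0) <->
  (forall a, \sum_i w i * p i 0 (c i) ^+ d * A a i = 0).
Proof.
have scaleK G i : G \is d.-homog -> p i 0 (c i) ^+ d * G.@[nu i] = G.@[p i 0].
  by move/meval_chart_dhomog->; rewrite mulrA -exprMn mulfV // expr1n mul1r.
split=> [wG a|wA G dG].
  have dX : 'X_[monomial a] \is [in K[r.+1], d.-homog].
    by rewrite dhomogX /= mdeg_monomial.
  rewrite -[RHS](wG _ dX); apply: eq_bigr => i _.
  by rewrite -scaleK // mulrA mxE mevalX.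
under eq_bigr do rewrite -scaleK // (meval_veronese _ _ dG) !mulr_sumr.
rewrite exchange_big big1 //= => a _.
transitivity (G@_(monomial a) * \sum_i w i * p i 0 (c i) ^+ d * A a i).
  by rewrite mulr_sumr; apply: eq_bigr => i _; ring.
by rewrite wA mulr0.
Qed.

(** Every relation between the columns of [A] is determined by its coefficients
    at the columns in [D], which are arbitrary. *)
Let free_Jacobian :
  row_free (\matrix_(k < #|D|, j < n * r) (hD k)^`M(j).@[x]) <->
  sing_evaluations_free d p F.
Proof.
have [lam lam0 lamE] := cofactor_F; split=> [Jfree w w0 wG|wfree].
  pose w1 i := w i * p i 0 (c i) ^+ d.
  have w1A : forall a, \sum_i w1 i * A a i = 0 by apply/relation_scale.
  suff w10 i : w1 i = 0.
    move=> i; have /eqP := w10 i; rewrite mulf_eq0 expf_eq0 (negPf (pc i)).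
    by rewrite andbF orbF => /eqP.
  have w1D k : k \in D -> w1 k = 0.
    move=> Dk; have : \row_k w1 (enum_val k) = 0 :> 'rV_#|D|.
      apply: (row_free_inj Jfree); rewrite mul0mx (Jacobian_relation lamE) //.
      apply/rowP => j; rewrite !mxE big1 ?mulr0 // => i' _.
      have [/dF_sing->|/w0] := boolP (in_sing F (p i')); first by rewrite mulr0.
      by rewrite /w1 => ->; rewrite !mul0r.
    by move=> /rowP/(_ (enum_rank_in Dk k)); rewrite !mxE enum_rankK_in.
  have [/w1D//|Di] := boolP (i \in D).
  have [b0 [nb0 fb0]] : exists b0, b0 != b /\ f b0 = i.
    move: Di; rewrite inE negb_forall => /existsP[b0].
    by rewrite negb_imply negbK => /andP[? /eqP]; exists b0.
  have [z zP] := border_cofactor_dual A f a1 nb0.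
  have : \sum_a z a * \sum_i w1 i * A a i = 0.
    by rewrite big1 // => a _; rewrite w1A mulr0.
  under eq_bigr do rewrite mulr_sumr.
  rewrite exchange_big (bigD1 i) //= [X in _ + X]big1.
    rewrite addr0 -fb0; under eq_bigr do rewrite mulrCA.
    rewrite -mulr_sumr zP // eqxx => /eqP; rewrite mulf_eq0 (negPf Ca1) orbF.
    by move/eqP.
  move=> i' ni; under eq_bigr do rewrite mulrCA.
  rewrite -mulr_sumr.
  have [/w1D->|] := boolP (i' \in D); first by rewrite mul0r.
  rewrite inE negb_forall => /existsP[b']; rewrite negb_imply negbK.
  move=> /andP[nb' /eqP fb']; rewrite -fb' zP //.
  case: eqP => [e|_]; last by rewrite mulr0.
  by rewrite -fb' -e fb0 eqxx in ni.
apply: inj_row_free => v vJ.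
pose col (k : 'I_#|D|) (b' : 'I_N) : 'I_n :=
  if b' == b then enum_val k else f b'.
have rel (k : 'I_#|D|) : exists w : 'I_N -> K,
    w b = border_cofactor A f b a1 /\
    forall a, \sum_b' w b' * A a (col k b') = 0.
  exact/bordered_minor_relation/minorA.
have [wk wkP] := fin_all_exists rel.
(* the relations of the columns in [D] with the base columns, combined such
   that the coefficients at [D] are those of [v] *)
pose w i := \sum_k v 0 k / border_cofactor A f b a1 *
              \sum_(b' | col k b' == i) wk k b'.
have wA a : \sum_i w i * A a i = 0.
  under eq_bigr do rewrite mulr_suml; rewrite exchange_big big1 //= => k _.
  under eq_bigr do rewrite -mulrA mulr_suml.
  rewrite -mulr_sumr [X in _ * X](_ : _ = 0) ?mulr0 // -[RHS]((wkP k).2 a).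
  rewrite [RHS](partition_big (col k) predT) //=; apply: eq_bigr => i _.
  by apply: eq_bigr => b' /eqP->.
have wD k : w (enum_val k) = v 0 k.
  rewrite /w (bigD1 k) //= [X in _ + X]big1 ?addr0.
    rewrite (big_pred1 b) => [|b']; first by rewrite (wkP k).1 divfK.
    rewrite /col /=; case: (eqVneq b' b) => [_|nb]; first by rewrite eqxx.
    by apply/negbTE/base_D => //; apply: enum_valP.
  move=> k' nk; rewrite big_pred0 ?mulr0 // => b'; rewrite /col.
  case: (eqVneq b' b) => [_|nb].
    by rewrite (inj_eq enum_val_inj) (negPf nk).
  by apply/negbTE/base_D => //; apply: enum_valP.
have wdF j : \sum_i w i * dF i j = 0.
  have := Jacobian_relation lamE wA.
  rewrite (_ : \row_k _ = v) ?vJ; last by apply/rowP => k; rewrite mxE wD.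
  move=> /rowP/(_ j); rewrite !mxE => /esym/eqP.
  by rewrite mulf_eq0 (negPf lam0) => /eqP.
have w0 i : w i / p i 0 (c i) ^+ d = 0.
  apply: (wfree (fun i => w i / p i 0 (c i) ^+ d)) => [i' ns|].
    by rewrite (sing_dF wdF ns) mul0r.
  by apply/relation_scale => a; under eq_bigr do rewrite divfK ?expf_neq0 //.
apply/rowP => k; rewrite mxE -wD; have /eqP := w0 (enum_val k).
by rewrite mulf_eq0 invr_eq0 expf_eq0 (negPf (pc _)) andbF orbF => /eqP.
Qed.

Lemma smooth_at_chart_bordered :
  smooth_at (max_minor (d := d) P) x <-> sing_evaluations_free d p F.
Proof.
have g0 t : (max_minor (d := d) P t).@[x] = 0.
  by rewrite /max_minor -det_map_mx map_mxsub mapV minorA.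
rewrite -free_Jacobian; apply: (smooth_atP g0).
  move=> G; split; apply: local_ideal_trans => k.
    exists (C a1); rewrite CA Ca1; split=> //.
    have [e ->] := minor_in_bordered V f b a1 k.
    by apply: ideal_gen_sum => j; apply: ideal_hD.
  apply: local_ideal_mem.
  have -> : hD k = max_minor (d := d) P
      [ffun b' => if b' == b then enum_val k else f b'].
    by rewrite /max_minor mxsub_ffunr.
  exact: ideal_gen_mem.
move=> a rel k.
pose a' i := \sum_(k' | enum_val k' == i) a k'.
have a'E k' : a' (enum_val k') = a k'.
  by rewrite /a' (big_pred1 k') // => l; rewrite (inj_eq enum_val_inj).
rewrite -a'E; apply: h_minimal (enum_valP k).
by rewrite big_enum_val -[RHS]rel; apply: eq_bigr => l _; rewrite a'E.
Qed.

End BorderedGenerators.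

Lemma smooth_at_chart :
  smooth_at (max_minor (d := d) P) x <-> sing_evaluations_free d p F.
Proof.
have [a1 Fa1] := F_coef.
have [|f [b C0]] := border_cofactor_neq0 (a := a1) (widen_ord n_ge a1) minorA.
  move=> v /rowP vA v0; have [|t tE] := kerA (v := v 0).
    by move=> i; have := vA i; rewrite !mxE.
  have /eqP := tE a1; rewrite v0 eq_sym mulf_eq0 (negPf Fa1) orbF => /eqP t0.
  by apply/rowP => a; rewrite tE t0 mul0r mxE.
exact: smooth_at_chart_bordered C0.
Qed.

End Chart.

(** Smoothness is tested in one chart, but the criterion does not depend on
    it. *)
Lemma smooth_point_XP (K : fieldType) (r d n : nat)
    (p : 'I_n -> 'rV[K]_r.+1) (F : {mpoly K[r.+1]}) :
  ('C(r + d, d) <= n)%N -> (forall i, p i != 0) ->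
  on_unique_hypersurface d p F ->
  smooth_point_X d p <-> sing_evaluations_free d p F.
Proof.
move=> n_ge p0 pF; split=> [[c [pc /(smooth_at_chart n_ge pF pc)]]//|Fp].
have /fin_all_exists[c pc] : forall i, exists j, p i 0 j != 0.
  move=> i; have /rV0Pn[j pj] := p0 i; by exists j.
by exists c; split=> //; apply/(smooth_at_chart n_ge pF pc).
Qed.

(** * The Cech differential on all subsets *)

Section CechSum.

Variables (S : comNzRingType) (n : nat).
Implicit Types (a : {set 'I_n} -> S) (s : {set 'I_n}) (j l : 'I_n).

Definition cech_sign s j : S := (-1) ^+ #|[set l in s | (l < j)%N]|.

(** This is [cech_d] over any ring: it is applied to rational functions, to
    their values at a point and to the coefficients of their numerators. *)
Definition cech_sum a s : S := \sum_(j in s) cech_sign s j * a (s :\ j).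

Definition cech_cone j a s : S :=
  if j \in s then 0 else cech_sign s j * a (j |: s).

Lemma cech_signK s j : cech_sign s j * cech_sign s j = 1.
Proof. by rewrite /cech_sign -expr2 sqrr_sign. Qed.

Lemma cech_signU1 s j l : l \notin s ->
  cech_sign (l |: s) j = (-1) ^+ (l < j)%N * cech_sign s j.
Proof.
move=> ls; rewrite /cech_sign -exprD; congr (_ ^+ _).
rewrite -!sum1_card (bigID (pred1 l)) /=.
have -> : \sum_(i in [set i in l |: s | (i < j)%N] | i == l) 1
          = (l < j)%N :> nat.
  rewrite (eq_bigl (fun i => (i == l) && (l < j)%N)) => [|i]; last first.
    by rewrite !inE; case: eqP => [->|]; rewrite ?andbT ?andbF.
  by rewrite big_mkcondr big_pred1_eq; case: (l < j)%N.
congr (_ + _)%N; apply: eq_bigl => i; rewrite !inE.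
by case: eqP => [->|]; rewrite ?andbT ?andbF ?(negPf ls).
Qed.

Lemma cech_signD1 s j : cech_sign (s :\ j) j = cech_sign s j.
Proof.
rewrite /cech_sign; congr (_ ^+ _); apply: eq_card => i; rewrite !inE.
by case: eqP => [->|]; rewrite ?ltnn ?andbF.
Qed.

(** The augmented Cech complex is a cone with any vertex [j] as its apex. *)
Lemma cech_coneP j a s :
  cech_sum (cech_cone j a) s + cech_cone j (cech_sum a) s = a s.
Proof.
have [js|js] := boolP (j \in s).
  rewrite /cech_cone js addr0 /cech_sum (bigD1 j) //= big1 => [|l /andP[ls nl]].
    by rewrite addr0 !inE eqxx setD1K // cech_signD1 mulrA cech_signK mul1r.
  by rewrite !inE eq_sym nl js mulr0.
rewrite /cech_cone (negPf js) /cech_sum big_setU1 //= mulrDr addrCA.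
rewrite setU1K // cech_signU1 // ltnn mul1r mulrA cech_signK mul1r.
rewrite -[RHS]addr0; congr (_ + _).
rewrite mulr_sumr -big_split big1 //= => l ls.
have jl : j != l by apply: contraNneq js => ->.
rewrite !inE (negPf js) andbF mulrA mulrA.
have -> : j |: s :\ l = (j |: s) :\ l.
  apply/setP => i; rewrite !inE; case: (i =P l) => // ->.
  by rewrite eq_sym (negPf jl).
rewrite -mulrDl cech_signU1 //.
have -> : cech_sign s j = (-1) ^+ (l < j)%N * cech_sign (s :\ l) j.
  by rewrite -[in LHS](setD1K ls) cech_signU1 // !inE eqxx.
have : (j < l)%N = ~~ (l < j)%N by rewrite -leqNgt ltn_neqAle jl.
by move=> ->; case: (l < j)%N; rewrite ?expr0 ?expr1 /=; ring.
Qed.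

(** Induction on the size of [s]: by [cech_coneP] for a vertex of [s], the
    double differential at [s] is one at the set without this vertex. *)
Lemma cech_sum_sum a s : cech_sum (cech_sum a) s = 0.
Proof.
elim: {s}#|s| {-2}s (erefl #|s|) a => [|m IHm] s sm a.
  by rewrite (cards0_eq sm) /cech_sum big_set0.
have [j js] : exists j, j \in s by apply/set0Pn; rewrite -card_gt0 sm.
have sD : #|s :\ j| = m by apply/eqP; rewrite -eqSS -sm (cardsD1 j s) js.
pose ha := cech_cone j a; pose t := s :\ j.
have tE : j |: t = s by apply: setD1K.
have jt : j \notin t by rewrite !inE eqxx.
have := cech_coneP j (cech_sum a) t.
have : cech_sum (cech_cone j (cech_sum a)) t = cech_sum a t.
  rewrite -[RHS]subr0 -(IHm t sD ha) /cech_sum -sumrB.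
  apply: eq_bigr => l lt.
  rewrite -mulrBr -[in X in _ * (X - _)](cech_coneP j a).
  by rewrite -/ha addrAC subrr add0r.
move=> -> /eqP; rewrite addrC -subr_eq0 addrK.
rewrite /cech_cone (negPf jt) tE => /eqP e.
by rewrite -[LHS]mul1r -(cech_signK t j) -mulrA e mulr0.
Qed.

Lemma eq_cech_sum a b s : (forall j, j \in s -> a (s :\ j) = b (s :\ j)) ->
  cech_sum a s = cech_sum b s.
Proof. by move=> ab; apply: eq_bigr => j js; rewrite ab. Qed.

Lemma cech_sumB a b s :
  cech_sum (fun t => a t - b t) s = cech_sum a s - cech_sum b s.
Proof. by rewrite -sumrB; apply: eq_bigr => j _; rewrite mulrBr. Qed.

Lemma cech_sum0 a s : (forall j, j \in s -> a (s :\ j) = 0) -> cech_sum a s = 0.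
Proof. by move=> a0; rewrite /cech_sum big1 // => j js; rewrite a0 ?mulr0. Qed.

Lemma cech_sum1 a j : cech_sum a [set j] = a set0.
Proof.
rewrite /cech_sum big_set1 setDv /cech_sign.
have -> : [set l in [set j] | (l < j)%N] = set0.
  by apply/setP => l; rewrite !inE; case: eqP => [->|//]; rewrite ltnn.
by rewrite cards0 expr0 mul1r.
Qed.

Lemma cech_sum_const_pair (y : S) s : #|s| = 2%N -> cech_sum (fun=> y) s = 0.
Proof.
move=> s2; rewrite -[RHS](cech_sum_sum (fun=> y) s); apply: eq_cech_sum => j js.
have /cards1P[l ->] : #|s :\ j| == 1%N by rewrite -eqSS -s2 (cardsD1 j s) js.
by rewrite cech_sum1.
Qed.

Lemma cech_sum_pair a i j : i != j ->
  cech_sum a [set i; j] = 0 -> a [set i] = a [set j].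
Proof.
wlog ij : i j / (i < j)%N.
  move=> W nij; have := nij; rewrite neq_ltn => /orP[|] lt_ij; first exact: W.
  by move=> e; apply/esym; apply: W => //; rewrite 1?eq_sym // setUC.
move=> nij; rewrite /cech_sum big_setU1 ?inE //= big_set1.
have -> : [set i; j] :\ i = [set j].
  apply/setP => l; rewrite !inE; case: (eqVneq l i) => // ->.
  by rewrite (negPf nij).
have -> : [set i; j] :\ j = [set i].
  apply/setP => l; rewrite !inE.
  case: (eqVneq l j) => [->|_] /=; last by rewrite orbF.
  by rewrite eq_sym (negPf nij).
rewrite /cech_sign.
have -> : [set l in [set i; j] | (l < i)%N] = set0.
  apply/setP => l; rewrite !inE; case: eqP => [->|_] /=; first by rewrite ltnn.
  by case: eqP => [->|//] /=; rewrite ltnNge ltnW.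
have -> : [set l in [set i; j] | (l < j)%N] = [set i].
  apply/setP => l; rewrite !inE; case: eqP => [->|_] /=; first by rewrite ij.
  by case: eqP => [->|//] /=; rewrite ltnn.
rewrite cards0 cards1 expr0 expr1 mul1r mulN1r => /eqP.
by rewrite subr_eq0 => /eqP.
Qed.

End CechSum.

(** * Values of rational functions at points *)

Section Values.

Variables (K : fieldType) (k : nat).
Local Notation R := {mpoly K[k]}.
Implicit Types (u w : {fraction R}) (v : 'I_k -> K) (y z : K).

(** [u] belongs to the local ring at [v] and has residue [y]. A function instead
    of a relation would have to choose a fraction for [u] whose denominator does
    not vanish at [v]. *)
Definition has_value v u y : Prop :=
  exists f g : R, [/\ g.@[v] != 0, u = f%:F / g%:F & y = f.@[v] / g.@[v]].

Let tofrac_neq0 v (g : R) : g.@[v] != 0 -> g%:F != 0.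
Proof. by rewrite tofrac_eq0; apply: contraNneq => ->; rewrite meval0. Qed.

Lemma has_value_unique v u y z : has_value v u y -> has_value v u z -> y = z.
Proof.
move=> [f [g [gv -> ->]]] [f' [g' [g'v /eqP + ->]]].
have g0 := tofrac_neq0 gv; have g'0 := tofrac_neq0 g'v.
rewrite (eqr_div _ _ g0 g'0) -!tofracM tofrac_eq => /eqP/(congr1 (meval v)).
by rewrite !mevalM => e; apply/eqP; rewrite eqr_div // e.
Qed.

Lemma has_value_tofrac v (f : R) : has_value v f%:F f.@[v].
Proof. by exists f, 1; rewrite meval1 oner_eq0 tofrac1 !divr1. Qed.

Lemma has_valueM v u w y z :
  has_value v u y -> has_value v w z -> has_value v (u * w) (y * z).
Proof.
move=> [f [g [gv -> ->]]] [f' [g' [g'v -> ->]]].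
exists (f * f'), (g * g'); rewrite !mevalM mulf_neq0 //; split=> //.
  by rewrite !tofracM mulf_div.
by rewrite mulf_div.
Qed.

Let subf_div (L : fieldType) (a b a' b' : L) : b != 0 -> b' != 0 ->
  a / b - a' / b' = (a * b' - a' * b) / (b * b').
Proof. by move=> b0 b'0; rewrite -mulNr addf_div // mulNr. Qed.

Lemma has_valueB v u w y z :
  has_value v u y -> has_value v w z -> has_value v (u - w) (y - z).
Proof.
move=> [f [g [gv -> ->]]] [f' [g' [g'v -> ->]]].
exists (f * g' - f' * g), (g * g'); rewrite !(mevalB, mevalM) mulf_neq0 //.
have g0 := tofrac_neq0 gv; have g'0 := tofrac_neq0 g'v.
split; first by [].
  by rewrite (subf_div _ _ g0 g'0) tofracB !tofracM.
exact: subf_div.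
Qed.

Lemma has_value0 v : has_value v 0 0.
Proof. by rewrite -tofrac0 -(meval0 v); apply: has_value_tofrac. Qed.

Lemma has_value_cech_sum v n (a : {set 'I_n} -> {fraction R})
    (b : {set 'I_n} -> K) (s : {set 'I_n}) :
  (forall j, j \in s -> has_value v (a (s :\ j)) (b (s :\ j))) ->
  has_value v (cech_sum a s) (cech_sum b s).
Proof.
move=> ab; rewrite /cech_sum; apply: (big_ind2 (has_value v)).
- exact: has_value0.
- move=> u y w z uy wz; rewrite -[w]opprK -[z]opprK -[- w]sub0r -[- z]sub0r.
  by do 2!apply: has_valueB => //; apply: has_value0.
move=> j js; apply: has_valueM; last exact: ab.
have -> : cech_sign {fraction R} s j = (cech_sign R s j)%:F.
  by rewrite /cech_sign rmorphXn rmorphN1.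
have -> : cech_sign K s j = (cech_sign R s j).@[v].
  by rewrite /cech_sign rmorphXn rmorphN1.
exact: has_value_tofrac.
Qed.

End Values.

(** * Twist sections *)

Section TwistSections.

Variables (K : fieldType) (r : nat).
Local Notation R := {mpoly K[r.+1]}.
Implicit Types (u w : {fraction R}) (s t : {set 'I_r.+1}) (m : int).

Local Notation twist := (twist_section (@unit_ideal K r)).

Definition coords s : R := \prod_(j in s) 'X_j.

Lemma coords_mnm s e :
  coords s ^+ e = 'X_[[multinom (if j \in s then e else 0%N) | j < r.+1]].
Proof.
rewrite /coords -prodrXl mpolyXE_id [LHS]big_mkcond; apply: eq_bigr => j _.
by rewrite mnmE; case: ifP.
Qed.

Lemma coords_dhomog s e : coords s ^+ e \is (e * #|s|)%N.-homog.
Proof.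
rewrite coords_mnm dhomogX /= mdegE; apply/eqP.
under eq_bigr do rewrite mnmE.
by rewrite -big_mkcond sum_nat_const mulnC.
Qed.

Lemma coords_neq0 s : coords s != 0.
Proof.
by rewrite -[coords s]expr1 coords_mnm -msupp_eq0 msuppX.
Qed.

Lemma coordsD s t : s \subset t -> coords t = coords s * coords (t :\: s).
Proof. by move=> st; rewrite /coords (big_setID s) (setIidPr st). Qed.

Lemma coordsF_neq0 s e : (coords s)%:F ^+ e != 0.
Proof. by rewrite expf_neq0 // tofrac_eq0 coords_neq0. Qed.

Lemma twistP m s u :
  twist m s u <-> exists (e k : nat) (f : R), [/\ f \is k.-homog,
    k%:Z = m + (e * #|s|)%N%:Z & u = f%:F / (coords s)%:F ^+ e].
Proof.
split=> [[e [k [f [_ fk km uE]]]]|[e [k [f [fk km uE]]]]]; exists e, k, f.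
  by split.
by split.
Qed.

Definition on_chart s (v : 'I_r.+1 -> K) := [forall j in s, v j != 0].

Lemma meval_coords s v : (coords s).@[v] != 0 = on_chart s v.
Proof.
rewrite rmorph_prod /=; apply/prodf_neq0/forall_inP => vs j js.
  by rewrite -(mevalXU v j) vs.
by rewrite mevalXU vs.
Qed.

Lemma twist_has_value m s u v : on_chart s v -> twist m s u ->
  exists y, has_value v u y.
Proof.
rewrite -meval_coords => vs /twistP[e [k [f [_ _ ->]]]].
exists (f.@[v] / (coords s ^+ e).@[v]), f, (coords s ^+ e); split=> //.
  by rewrite rmorphXn expf_neq0.
by rewrite tofracXn.
Qed.

Lemma twist_subset m s t u : s \subset t -> twist m s u -> twist m t u.
Proof.
move=> st /twistP[e [k [f [fk km ->]]]]; apply/twistP.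
exists e, (k + e * #|t :\: s|)%N, (f * coords (t :\: s) ^+ e); split.
- by rewrite dhomogM // coords_dhomog.
- rewrite -(cardsID s t) (setIidPr st) mulnDr !PoszD km; ring.
rewrite (coordsD st) !tofracM tofracXn exprMn -mulf_div divff ?mulr1 //.
exact: coordsF_neq0.
Qed.

Lemma twistB m s u w : twist m s u -> twist m s w -> twist m s (u - w).
Proof.
move=> /twistP[e [k [f [fk km ->]]]] /twistP[e' [k' [f' [f'k km' ->]]]].
apply/twistP; exists (e + e')%N, (k + e' * #|s|)%N.
exists (f * coords s ^+ e' - f' * coords s ^+ e); split.
- apply: rpredB; first by rewrite dhomogM // coords_dhomog.
  have -> : (k + e' * #|s| = k' + e * #|s|)%N by lia.
  by rewrite dhomogM // coords_dhomog.
- by rewrite PoszD km -addrA -PoszD -mulnDl.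
rewrite tofracB !tofracM !tofracXn -mulNr addf_div ?coordsF_neq0 // !mulNr.
by rewrite exprD.
Qed.

Lemma twist0 m s : s != set0 -> twist m s 0.
Proof.
rewrite -card_gt0 => s0; apply/twistP.
exists (absz m), (absz (m + (absz m * #|s|)%N%:Z)), 0; rewrite rpred0.
split=> //; last by rewrite tofrac0 mul0r.
have : (absz m <= absz m * #|s|)%N by rewrite leq_pmulr.
by move: (absz m * _)%N => e; lia.
Qed.

Lemma twistN m s u : twist m s u -> twist m s (- u).
Proof.
move=> /twistP[e [k [f [fk km ->]]]]; apply/twistP; exists e, k, (- f).
by rewrite rpredN tofracN mulNr.
Qed.

Lemma twistD m s u w : twist m s u -> twist m s w -> twist m s (u + w).
Proof.
by move=> us ws; rewrite -[w]opprK; apply: twistB => //; apply: twistN.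
Qed.

Lemma twist_cech_sum m s (a : {set 'I_r.+1} -> {fraction R}) : s != set0 ->
  (forall j, j \in s -> twist m (s :\ j) (a (s :\ j))) ->
  twist m s (cech_sum a s).
Proof.
move=> s0 aT; rewrite /cech_sum; apply: big_ind; first exact: twist0.
  by move=> u w; apply: twistD.
move=> j js; have /(twist_subset (subD1set s j)) aj := aT j js.
rewrite /cech_sign -signr_odd; case: (odd _); rewrite ?mul1r // mulN1r.
exact: twistN.
Qed.

(** The numerator of a section with value zero at the points of the chart may
    not vanish at the other points, but one more factor [coords s] in numerator
    and denominator makes it vanish there. *)
Lemma twist_vanishingP q m s u :
  twist_section (vanishing_ideal q) m s u <-> twist m s u /\
  forall v, v \in q -> on_chart s (v 0) -> has_value (v 0) u 0.
Proof.
split=> [[e [k [f [fJ fk km uE]]]]|[/twistP[e [k [f [fk km uE]]]] u0]].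
  split=> [|v vq vs]; first by apply/twistP; exists e, k, f.
  exists f, (coords s ^+ e); split; rewrite ?tofracXn ?rmorphXn ?expf_neq0 //=.
    by rewrite meval_coords.
  have := fJ v vq k; rewrite pihomog_dE // => ->; by rewrite mul0r.
exists e.+1, (k + #|s|)%N, (f * coords s).
have fsk : f * coords s \is (k + #|s|)%N.-homog.
  by rewrite dhomogM // -[coords s]expr1 -[#|s|]mul1n coords_dhomog.
split=> //.
- move=> v vq k'; have [->|nk] := eqVneq k' (k + #|s|)%N; last first.
    by rewrite (pihomog_ne0 _ fsk) ?meval0 // eq_sym.
  rewrite pihomog_dE // mevalM.
  have [vs|] := boolP (on_chart s (v 0)); last first.
    by rewrite -meval_coords negbK => /eqP->; rewrite mulr0.
  have fv : has_value (v 0) u (f.@[v 0] / (coords s ^+ e).@[v 0]).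
    exists f, (coords s ^+ e); split; rewrite ?tofracXn //.
    by rewrite rmorphXn expf_neq0 // meval_coords.
  have /eqP := has_value_unique fv (u0 v vq vs); rewrite mulf_eq0 invr_eq0.
  have /negPf-> : (coords s ^+ e).@[v 0] != 0.
    by rewrite rmorphXn expf_neq0 // meval_coords.
  by rewrite orbF => /eqP->; rewrite mul0r.
- by rewrite mulSn !PoszD km; ring.
rewrite uE tofracM exprSr -mulf_div divff ?mulr1 //.
by rewrite tofrac_eq0 coords_neq0.
Qed.

End TwistSections.

(** * Cohomology of the twisted structure sheaf *)

Section StructureSheaf.

Variables (K : fieldType) (r : nat).
Local Notation R := {mpoly K[r.+1]}.
Implicit Types (u w : {fraction R}) (s t : {set 'I_r.+1}) (m : int).
Implicit Types (f g : R) (mu : 'X_{1..r.+1}).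

Local Notation twist := (twist_section (@unit_ideal K r)).
Local Notation full := [set: 'I_r.+1].

(** Once the common denominator [(x_0 ... x_r)^E] is fixed, the sections over
    the chart [s] are the numerators of the right degree in which the
    coordinates outside of [s] occur with exponent at least [E]. *)
Definition numerator (E D : nat) s f : Prop :=
  forall mu, mu \in msupp f ->
    mdeg mu = D /\ forall j, j \notin s -> (E <= mu j)%N.

Lemma twist_numerator m s u : twist m s u -> exists E0, forall E D,
  (E0 <= E)%N -> D%:Z = m + (E * r.+1)%N%:Z ->
  exists2 f, numerator E D s f & u = f%:F / (coords K full)%:F ^+ E.
Proof.
move=> /twistP[e [k [f [fk km ->]]]]; exists e => E D eE Dm.
have sE : (e * #|s| + (E - e) * #|s| + E * #|~: s| = E * r.+1)%N.
  by rewrite -mulnDl subnKC // -mulnDr cardsC card_ord.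
have DE : D = (k + (E - e) * #|s| + E * #|~: s|)%N.
  move: sE Dm km; move: (e * #|s|)%N ((E - e) * #|s|)%N (E * #|~: s|)%N.
  by move: (E * r.+1)%N => *; lia.
exists (f * coords K s ^+ (E - e) * coords K (~: s) ^+ E).
  move=> mu mu_f; split.
    by apply: dhomog_mf mu_f; rewrite DE !dhomogM // coords_dhomog.
  move=> j js; move: mu_f; rewrite !coords_mnm (perm_mem (msuppMX _ _)).
  by move=> /mapP[nu _ ->]; rewrite mnmDE mnmE inE js leq_addr.
have fullE : coords K full ^+ E =
    coords K s ^+ e * (coords K s ^+ (E - e) * coords K (~: s) ^+ E).
  by rewrite (coordsD K (subsetT s)) setTD exprMn mulrA -exprD subnKC.
rewrite -[X in _ = _ / X]tofracXn fullE !tofracM !tofracXn -mulrA -mulf_div.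
by rewrite divff ?mulr1 // mulf_neq0 ?coordsF_neq0.
Qed.

Lemma numerator_twist m s f E D : D%:Z = m + (E * r.+1)%N%:Z ->
  numerator E D s f -> f = 0 \/ twist m s (f%:F / (coords K full)%:F ^+ E).
Proof.
move=> Dm numf; have [->|f0] := eqVneq f 0; [by left | right].
pose m0 := [multinom (if j \in ~: s then E else 0%N) | j < r.+1].
pose f' := \sum_(mu <- msupp f) f@_mu *: 'X_[mu - m0].
have subK mu : mu \in msupp f -> (mu - m0 + m0)%MM = mu.
  move=> /numf[_ muE]; apply: submK; apply/mnm_lepP => j; rewrite mnmE inE.
  by have [//|js] := boolP (j \in s); rewrite muE.
have fE : f = f' * coords K (~: s) ^+ E.
  rewrite coords_mnm {1}[f]mpolyE mulr_suml !big_seq; apply: eq_bigr => mu mu_f.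
  by rewrite -scalerAl -mpolyXD subK.
have m0deg : mdeg m0 = (E * #|~: s|)%N.
  rewrite mdegE; under eq_bigr do rewrite mnmE.
  by rewrite -big_mkcond sum_nat_const mulnC.
have degD mu : mu \in msupp f -> D = (mdeg (mu - m0)%MM + E * #|~: s|)%N.
  by move=> mu_f; rewrite -m0deg -mdegD subK //; have [] := numf mu mu_f.
have sE : (E * #|s| + E * #|~: s| = E * r.+1)%N.
  by rewrite -mulnDr cardsC card_ord.
have D_ge : (E * #|~: s| <= D)%N.
  by rewrite (degD (mlead f)) ?leq_addl // mlead_supp.
apply/twistP; exists E, (D - E * #|~: s|)%N, f'; split.
- rewrite /f' big_seq; apply: rpred_sum => mu mu_f.
  by rewrite rpredZ // dhomogX /= (degD mu mu_f) addnK.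
- move: sE D_ge Dm; move: (E * #|s|)%N (E * #|~: s|)%N (E * r.+1)%N => *; lia.
rewrite {1}fE (coordsD K (subsetT s)) setTD !tofracM !tofracXn exprMn -mulf_div.
by rewrite divff ?mulr1 // coordsF_neq0.
Qed.

(** The numerators of [u] over two different charts agree, so that all
    coordinates can be cancelled. If [m] is negative, only [u = 0] is left, and
    [k] is arbitrary. *)
Lemma twist_glue m u : (0 < r)%N -> (forall j, twist m [set j] u) ->
  exists f k, [/\ u = f%:F, f \is k.-homog & f = 0 \/ k%:Z = m].
Proof.
move=> r0 uT; pose j0 : 'I_r.+1 := ord0; pose j1 : 'I_r.+1 := inord 1.
have j01 : j0 != j1 by rewrite -val_eqE /= inordK.
have [E0 P0] := twist_numerator (uT j0).
have [E1 P1] := twist_numerator (uT j1).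
pose E := (E0 + E1 + absz m)%N.
have EM : (absz m <= E * r.+1)%N.
  by apply: leq_trans (leq_pmulr _ _) => //; rewrite leq_addl.
have [D Dm] : exists D : nat, D%:Z = m + (E * r.+1)%N%:Z.
  exists (absz (m + (E * r.+1)%N%:Z)); move: EM; move: (E * r.+1)%N => *; lia.
have [|f0 num0 uf0] := P0 E D _ Dm; first by rewrite /E -addnA leq_addr.
have [|f1 num1 uf1] := P1 E D _ Dm.
  by rewrite /E addnAC leq_addl.
have e01 : f0 = f1.
  apply/eqP; rewrite -tofrac_eq; apply/eqP.
  by apply: (mulIf (invr_neq0 (coordsF_neq0 K full E))); rewrite -uf0 -uf1.
have num : numerator E D set0 f0.
  move=> mu mu_f; have [degm mu0] := num0 mu mu_f; split=> // j _.
  have [->|jj] := eqVneq j j0; last by apply: mu0; rewrite inE.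
  by rewrite e01 in mu_f; have [_ ->] := num1 mu mu_f; rewrite // inE.
have [f00|/twistP[e [k [f [fk km uf]]]]] := numerator_twist Dm num.
  by exists 0, 0%N; rewrite rpred0 uf0 f00 !tofrac0 mul0r; split=> //; left.
exists f, k; split=> //; last by right; rewrite km cards0 muln0 addr0.
by rewrite uf0 uf /coords big_set0 tofrac1 expr1n divr1.
Qed.

(** Both the cochains and the differential decompose along the monomials [mu] of
    the numerators. If [E <= mu j], then [mu] may occur over [s] as soon as it
    may occur over [j |: s], so that the part along [mu] is contracted by the
    cone with apex [j]. If there is no such [j], then [mu] can only occur over
    the set of all coordinates, and its degree is at most (E - 1)(r + 1), which
    is too small by the bound on [m]. *)
Lemma cohomology_structure_sheaf m i : - r.+1%:Z < m ->
  cohomology_vanishesS (@unit_ideal K r) m i.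
Proof.
move=> m_gt a aT a_cocycle.
have [E0 E0P] : exists E0 : {set 'I_r.+1} -> nat, forall s, #|s| = i.+2 ->
    forall E D, (E0 s <= E)%N -> D%:Z = m + (E * r.+1)%N%:Z ->
    exists2 f, numerator E D s f & a s = f%:F / (coords K full)%:F ^+ E.
  apply: (fin_all_exists (P := fun s e => #|s| = i.+2 -> forall E D,
    (e <= E)%N -> D%:Z = m + (E * r.+1)%N%:Z ->
    exists2 f, numerator E D s f & a s = f%:F / (coords K full)%:F ^+ E)) => s.
  have [si|si] := eqVneq #|s| i.+2; last first.
    by exists 0%N => /eqP; rewrite (negPf si).
  by have [e eP] := twist_numerator (aT s si); exists e.
(* the summand [absz m] makes the degree [D] of the numerators nonnegative *)
pose E := (\max_s E0 s + absz m)%N.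
have EM : (absz m <= E * r.+1)%N.
  by apply: leq_trans (leq_pmulr _ _) => //; rewrite leq_addl.
have [D Dm] : exists D : nat, D%:Z = m + (E * r.+1)%N%:Z.
  exists (absz (m + (E * r.+1)%N%:Z)); move: EM; move: (E * r.+1)%N => *; lia.
have [f fP] : exists f : {set 'I_r.+1} -> R, forall s, #|s| = i.+2 ->
    numerator E D s (f s) /\ a s = (f s)%:F / (coords K full)%:F ^+ E.
  apply: (fin_all_exists (P := fun s g => #|s| = i.+2 ->
    numerator E D s g /\ a s = g%:F / (coords K full)%:F ^+ E)) => s.
  have [si|si] := eqVneq #|s| i.+2; last first.
    by exists 0 => /eqP; rewrite (negPf si).
  have [|g g1 g2] := E0P s si E D _ Dm; last by exists g.
  by apply: leq_trans (leq_addr _ _); apply: leq_bigmax.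
have frac_sum (g : {set 'I_r.+1} -> R) s :
    cech_sum (fun t => (g t)%:F / (coords K full)%:F ^+ E) s
    = (cech_sum g s)%:F / (coords K full)%:F ^+ E.
  rewrite /cech_sum rmorph_sum mulr_suml; apply: eq_bigr => j _ /=.
  by rewrite mulrA tofracM /cech_sign rmorphXn rmorphN1.
have coef_sum (g : {set 'I_r.+1} -> R) mu s :
    (cech_sum g s)@_mu = cech_sum (fun t => (g t)@_mu) s.
  rewrite /cech_sum raddf_sum; apply: eq_bigr => j _ /=.
  have -> : cech_sign R s j = (cech_sign K s j)%:MP.
    by rewrite /cech_sign !rmorphXn /= mpolyCN mpolyC1.
  by rewrite mul_mpolyC mcoeffZ.
pose fmu mu t := (f t)@_mu.
have f_cocycle mu s : #|s| = i.+3 -> cech_sum (fmu mu) s = 0.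
  move=> si; rewrite -coef_sum; have /eqP := a_cocycle s si.
  have -> : cech_d a s = (cech_sum f s)%:F / (coords K full)%:F ^+ E.
    rewrite -frac_sum; apply: eq_cech_sum => j js.
    have /fP[_ ->//] : #|s :\ j| = i.+2.
    by apply/eqP; rewrite -eqSS -si (cardsD1 j s) js.
  rewrite mulf_eq0 invr_eq0 (negPf (coordsF_neq0 K full E)) orbF tofrac_eq0.
  by move=> /eqP->; rewrite mcoeff0.
pose apex mu := [pick j | E <= mu j]%N.
pose gmu s mu := if apex mu is Some j then cech_cone j (fmu mu) s else 0.
pose l := undup (flatten [seq msupp (f t) | t : {set 'I_r.+1}]).
pose g s := \sum_(mu <- l) gmu s mu *: 'X_[mu].
have gE s mu : (g s)@_mu = gmu s mu.
  rewrite /g (raddf_sum (mcoeff mu)) /=.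
  have [mu_l|mu_l] := boolP (mu \in l).
    rewrite (bigD1_seq mu) ?undup_uniq //= mcoeffZ mcoeffX eqxx mulr1.
    by rewrite big1 ?addr0 // => nu /negPf nn; rewrite mcoeffZ mcoeffX nn mulr0.
  rewrite big_seq big1 => [|nu nu_l]; last first.
    rewrite mcoeffZ mcoeffX; case: eqP => [e|]; rewrite ?mulr0 //.
    by rewrite -e nu_l in mu_l.
  rewrite /gmu; case: (apex mu) => // j; rewrite /cech_cone; case: ifP => // _.
  rewrite /fmu memN_msupp_eq0 ?mulr0 //; apply: contra mu_l => mu_f.
  by rewrite mem_undup; apply/flatten_mapP; exists (j |: s); rewrite ?mem_enum.
exists (fun s => (g s)%:F / (coords K full)%:F ^+ E).
  move=> s si; have [|->|//] := numerator_twist (s := s) (f := g s) Dm.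
  - move=> mu; rewrite mcoeff_msupp gE /gmu /apex.
    case: pickP => [j Ej|]; last by rewrite eqxx.
    rewrite /cech_cone; case: ifP => [_|js]; first by rewrite eqxx.
    move=> nz; have ji : #|j |: s| = i.+2 by rewrite cardsU1 js si.
    have [|degm muE] := (fP _ ji).1 mu.
      rewrite mcoeff_msupp; apply: contraNneq nz; rewrite /fmu => ->.
      by rewrite mulr0.
    split=> // j' j's; have [->//|jj] := eqVneq j' j.
    by apply: muE; rewrite !inE negb_or jj.
  - by rewrite tofrac0 mul0r; apply: twist0; rewrite -card_gt0 si.
move=> s si; rewrite -[RHS]/(cech_sum _ s) frac_sum (fP s si).2.
congr (_%:F / _).
apply/mpolyP => mu; rewrite coef_sum.
rewrite (eq_cech_sum (b := gmu^~ mu)) => [|j _]; last exact: gE.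
rewrite /gmu; case E1 : (apex mu) => [j|]; last first.
  rewrite cech_sum0 //; apply/eqP; rewrite mcoeff_eq0; apply/negP => mu_f.
  have small j : (mu j < E)%N.
    move: E1; rewrite /apex; case: pickP => // /(_ j) + _.
    by rewrite ltnNge => ->.
  have [degm _] := (fP s si).1 mu mu_f.
  have : (mdeg mu + r.+1 <= E * r.+1)%N.
    have -> : (mdeg mu + r.+1 = \sum_(j < r.+1) (mu j).+1)%N.
      under eq_bigr do rewrite -addn1.
      by rewrite big_split /= sum_nat_const card_ord muln1 mdegE.
    have -> : (E * r.+1 = \sum_(j < r.+1) E)%N.
      by rewrite sum_nat_const card_ord mulnC.
    by apply: leq_sum => j _.
  move: Dm; rewrite degm; move: (E * r.+1)%N => *; lia.
rewrite -[LHS](cech_coneP j (fmu mu)) -[RHS]addr0; congr (_ + _).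
rewrite /cech_cone; case: ifP => // js; rewrite f_cocycle ?mulr0 //.
by rewrite cardsU1 js si.
Qed.

End StructureSheaf.

(** * Separating points by forms *)

Lemma exists_on_seq (T : eqType) (U : Type) (u0 : U) (q : seq T)
    (P : T -> U -> Prop) :
  (forall v, v \in q -> exists y, P v y) ->
  exists y : T -> U, forall v, v \in q -> P v (y v).
Proof.
elim: q => [|v q IHq] Pq; first by exists (fun=> u0).
have [y yP] := IHq (fun w wq => Pq w (mem_behead (s := v :: q) wq)).
have [z zP] := Pq v (mem_head v q).
exists (fun w => if w == v then z else y w) => w; rewrite inE.
by case: eqP => [->//|_] /=; apply: yP.
Qed.

Section Points.

Variables (K : fieldType) (r : nat) (q : seq 'rV[K]_r.+1).
Local Notation R := {mpoly K[r.+1]}.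
Local Notation twist := (twist_section (@unit_ideal K r)).
Implicit Types (v w : 'rV[K]_r.+1) (d e : nat) (m : int) (s : {set 'I_r.+1}).

Hypothesis q_neq0 : forall v, v \in q -> v != 0.

Definition separated_by_forms d : Prop := forall v, v \in q ->
  exists G : R, [/\ G \is d.-homog, G.@[v 0] != 0 &
    forall w, w \in q -> w != v -> G.@[w 0] = 0].

Let coord_neq0 v : v \in q -> exists j, v 0 j != 0.
Proof. by move=> /q_neq0 /rV0Pn. Qed.

Lemma separated_by_forms_leq d e : (d <= e)%N ->
  separated_by_forms d -> separated_by_forms e.
Proof.
move=> de sep v vq; have [G [dG Gv Gw]] := sep v vq.
have [j vj] := coord_neq0 vq; exists (G * 'X_j ^+ (e - d)); split.
- have dX : 'X_j ^+ (e - d) \is [in K[r.+1], (1 * (e - d)).-homog].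
    by rewrite dhomogMn // dhomogX /= mdeg1.
  by have := dhomogM dG dX; rewrite mul1n subnKC.
- by rewrite mevalM rmorphXn /= mevalXU mulf_neq0 // expf_neq0.
- by move=> w wq nw; rewrite mevalM Gw // mul0r.
Qed.

Lemma interpolate d (y : 'rV[K]_r.+1 -> K) : separated_by_forms d ->
  exists2 f : R, f \is d.-homog & forall v, v \in q -> f.@[v 0] = y v.
Proof.
move=> /(exists_on_seq (0 : R))[G GP].
exists (\sum_(v <- undup q) (y v / (G v).@[v 0]) *: G v).
  rewrite big_seq; apply: rpred_sum => v; rewrite mem_undup => vq.
  by rewrite rpredZ //; have [] := GP v vq.
move=> v vq; rewrite (raddf_sum (meval _)) /=.
rewrite (bigD1_seq v) ?mem_undup ?undup_uniq //=.
rewrite mevalZ divfK; last by have [] := GP v vq.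
rewrite big_seq_cond big1 ?addr0 // => w /andP[]; rewrite mem_undup => wq nw.
by have [_ _ Gw] := GP w wq; rewrite mevalZ (Gw v) ?mulr0 // eq_sym.
Qed.

Hypothesis q_distinct : {in q &, forall v w, v != w -> ~~ same_point v w}.

(** A product of linear forms, one through each of the other points. *)
Lemma separated_by_large_forms d : (size q <= d)%N -> separated_by_forms d.
Proof.
move=> qd; apply: (separated_by_forms_leq qd) => v vq.
suff [G [dG Gv Gw]] : exists G : R, [/\ G \is (size q).-homog, G.@[v 0] != 0 &
    forall w, w \in q -> w != v -> G.@[w 0] = 0] by exists G.
elim: {-2}q (fun w (wq : w \in q) => wq) => [_|w q' IHq q'q].
  by exists 1; rewrite meval1 oner_eq0 dhomog1.
have [w' /(mem_behead (s := w :: q'))|G [dG Gv Gw]] := IHq; first exact: q'q.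
have wq : w \in q by apply: q'q; apply: mem_head.
suff [L [dL Lv Lw]] : exists L : R, [/\ L \is 1.-homog, L.@[v 0] != 0 &
    w != v -> L.@[w 0] = 0].
  exists (L * G); rewrite mevalM mulf_neq0 //= -[(size q').+1]add1n dhomogM //.
  split=> // w'; rewrite inE mevalM => /orP[/eqP->|w'q] nw.
    by rewrite Lw ?mul0r.
  by rewrite Gw ?mulr0.
have [wv|nwv] := eqVneq w v.
  have [j vj] := coord_neq0 vq; exists 'X_j.
  by rewrite dhomogX /= mdeg1 mevalXU.
have [j wj] := coord_neq0 wq.
have [l vl] : exists l, v 0 l * w 0 j != v 0 j * w 0 l.
  apply/existsP; apply: contraNT (q_distinct vq wq _); last by rewrite eq_sym.
  rewrite negb_exists => /forallP vw; rewrite /same_point.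
  have vE : v = (v 0 j / w 0 j) *: w.
    apply/rowP => l; rewrite mxE mulrAC; apply: (mulIf wj).
    by rewrite divfK //; apply/eqP; have := vw l; rewrite negbK.
  have c0 : v 0 j / w 0 j != 0.
    by apply: contraNneq (q_neq0 vq) => c0; rewrite vE c0 scale0r.
  by apply/eqmxP; rewrite vE; apply: eqmx_scale.
exists (w 0 j *: 'X_l - w 0 l *: 'X_j).
have dX i : 'X_i \is [in K[r.+1], 1.-homog] by rewrite dhomogX /= mdeg1.
split.
- by rewrite rpredB // rpredZ.
- by rewrite mevalB !mevalZ !mevalXU subr_eq0 mulrC [_ * v 0 j]mulrC.
- by rewrite mevalB !mevalZ !mevalXU mulrC subrr.
Qed.

(** The denominator is taken large enough for the numerators to separate the
    points. *)
Lemma sections_interpolate m s (y : 'rV[K]_r.+1 -> K) : s != set0 ->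
  exists2 u, twist m s u &
    forall v, v \in q -> on_chart s (v 0) -> has_value (v 0) u (y v).
Proof.
move=> s0; pose e := (size q + absz m)%N.
have [k km] : exists k : nat, k%:Z = m + (e * #|s|)%N%:Z.
  exists (absz (m + (e * #|s|)%N%:Z)).
  have : (absz m <= e * #|s|)%N.
    by apply: leq_trans (leq_pmulr _ _); rewrite ?card_gt0 // leq_addl.
  move: (e * #|s|)%N => *; lia.
have qk : (size q <= k)%N.
  have : (size q + absz m <= e * #|s|)%N by apply: leq_pmulr; rewrite card_gt0.
  move: km; move: (e * #|s|)%N => *; lia.
have [f fk fv] := interpolate (fun v => y v * (coords K s ^+ e).@[v 0])
  (separated_by_large_forms qk).
exists (f%:F / (coords K s)%:F ^+ e); first by apply/twistP; exists e, k, f.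
move=> v vq vs; have xv : (coords K s ^+ e).@[v 0] != 0.
  by rewrite rmorphXn expf_neq0 // meval_coords.
by exists f, (coords K s ^+ e); rewrite tofracXn fv // mulfK.
Qed.

(** * Normality and regularity of the ideal of points *)

(** A section of the structure sheaf of the points amounts to a value at each
    point, in the trivializations given by the coordinates of its vector, and
    all families of values occur. *)
Lemma d_normalP d : d_normal (vanishing_ideal q) d <-> separated_by_forms d.
Proof.
split=> [norm v0 v0q|sep t tT tJ].
  have /fin_all_exists[t tP] (j : 'I_r.+1) : exists u : {fraction R},
      twist d [set j] u /\ forall v, v \in q -> on_chart [set j] (v 0) ->
        has_value (v 0) u (v == v0)%:R.
    have [|u uT uv] := @sections_interpolate d [set j] (fun v => (v == v0)%:R).
      by rewrite -card_gt0 cards1.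
    by exists u.
  have [||f df fJ] := norm t; first by move=> j; apply: (tP j).1.
    move=> i j; apply/twist_vanishingP; split.
      apply: twistB;
        [apply: twist_subset (tP i).1|apply: twist_subset (tP j).1];
      by rewrite sub1set !inE eqxx ?orbT.
    move=> v vq /forall_inP vij; rewrite -(subrr (v == v0)%:R).
    by apply: has_valueB; [apply: (tP i).2|apply: (tP j).2] => //;
      apply/forall_inP => l /set1P->; apply: vij; rewrite !inE eqxx ?orbT.
  have fv v : v \in q -> f.@[v 0] = (v == v0)%:R.
    move=> vq; have [j vj] := coord_neq0 vq.
    have vs : on_chart [set j] (v 0) by apply/forall_inP => l /set1P->.
    have /twist_vanishingP[_ /(_ v vq vs) ftv] := fJ j.
    have := has_valueB (has_value_tofrac (v 0) f) ((tP j).2 v vq vs).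
    by move=> /(has_value_unique ftv)/esym/eqP; rewrite subr_eq0 => /eqP.
  exists f; split=> //; first by rewrite fv // eqxx oner_eq0.
  by move=> w wq /negPf nw; rewrite fv // nw.
have /(exists_on_seq 0)[y yP] v : v \in q -> exists z : K,
    forall j, v 0 j != 0 -> has_value (v 0) (t j) z.
  move=> vq; have [j vj] := coord_neq0 vq.
  have on1 i : v 0 i != 0 -> on_chart [set i] (v 0).
    by move=> vi; apply/forall_inP => l /set1P->.
  have [y yv] := twist_has_value (on1 j vj) (tT j).
  exists y => i vi; have [z zv] := twist_has_value (on1 i vi) (tT i).
  have /twist_vanishingP[_ tv] := tJ i j.
  have /(has_value_unique (has_valueB zv yv))/eqP :
      has_value (v 0) (t i - t j) 0.
    by apply: tv => //; apply/forall_inP => l /set2P[]->.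
  by rewrite subr_eq0 => /eqP <-.
have [f df fv] := interpolate y sep; exists f => // j.
apply/twist_vanishingP; split.
  apply: twistB (tT j); apply: (twist_subset (sub0set _)); apply/twistP.
  exists 0%N, d, f; split=> //; first by rewrite mul0n addr0.
  by rewrite expr0 divr1.
move=> v vq /forall_inP vs; rewrite -(subrr (y v)) -{1}(fv v vq).
apply: has_valueB; first exact: has_value_tofrac.
by apply: yP => //; apply: vs; rewrite inE.
Qed.

Let on_chart_sub s s' v : s \subset s' -> on_chart s' (v 0) -> on_chart s (v 0).
Proof. by move=> /subsetP ss /forall_inP vs; apply/forall_inP => j /ss/vs. Qed.

(** A cocycle of the ideal sheaf bounds a cochain [b] of the structure sheaf.
    The values of [b] at a point form a cocycle, which is the differential of
    its cone over a chart containing the point. Interpolating this cone at all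
    points gives a cochain of the structure sheaf whose differential corrects
    [b] to a cochain of the ideal sheaf. For [i = 0] the cone ends in the
    augmentation, and the forms of degree [m] have to be interpolated. *)
Lemma cohomology_ideal_points m i : - r.+1%:Z < m ->
  (forall s (y : 'rV[K]_r.+1 -> K), #|s| = i -> exists2 u, twist m s u &
     forall v, v \in q -> on_chart s (v 0) -> has_value (v 0) u (y v)) ->
  cohomology_vanishesS (vanishing_ideal q) m i.
Proof.
move=> m_gt interp a aJ a_cocycle.
have aT s : #|s| = i.+2 -> twist m s (a s).
  by move=> /aJ/twist_vanishingP[].
have [b bT abE] := cohomology_structure_sheaf m_gt aT a_cocycle.
have [apex apexP] := exists_on_seq ord0 coord_neq0.
have /(exists_on_seq (fun=> 0))[beta betaP] v : v \in q ->
    exists be : {set 'I_r.+1} -> K, forall s, #|s| = i.+1 ->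
      on_chart s (v 0) -> has_value (v 0) (b s) (be s).
  move=> vq; apply: (fin_all_exists (P := fun s y => #|s| = i.+1 ->
    on_chart s (v 0) -> has_value (v 0) (b s) y)) => s.
  have [si|si] := eqVneq #|s| i.+1; last first.
    by exists 0 => /eqP; rewrite (negPf si).
  have [vs|vs] := boolP (on_chart s (v 0)); last by exists 0.
  by have [y yv] := twist_has_value vs (bT s si); exists y.
have cardD s j k : #|s| = k.+1 -> j \in s -> #|s :\ j| = k.
  by move=> sk js; apply/eqP; rewrite -eqSS -sk (cardsD1 j s) js.
have beta_cocycle v s : v \in q -> #|s| = i.+2 -> on_chart s (v 0) ->
    cech_sum (beta v) s = 0.
  move=> vq si vs; have /twist_vanishingP[_ /(_ v vq vs)] := aJ s si.
  rewrite (abE s si) => a0; apply: (has_value_unique _ a0).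
  apply: has_value_cech_sum => j js.
  apply: betaP => //; first exact: cardD si js.
  exact: on_chart_sub (subD1set s j) vs.
have /fin_all_exists[c cP] (s : {set 'I_r.+1}) : exists u,
    #|s| = i -> twist m s u /\ forall v, v \in q -> on_chart s (v 0) ->
      has_value (v 0) u (cech_cone (apex v) (beta v) s).
  have [si|si] := eqVneq #|s| i; last by exists 0 => /eqP; rewrite (negPf si).
  have [u uT uv] := interp s (fun v => cech_cone (apex v) (beta v) s) si.
  by exists u.
exists (fun s => b s - cech_sum c s) => s si; last first.
  rewrite -[RHS]/(cech_sum _ s) cech_sumB cech_sum_sum subr0; exact: abE.
apply/twist_vanishingP; split.
  apply: twistB; first exact: bT.
  apply: twist_cech_sum => [|j js]; first by rewrite -card_gt0 si.
  exact: (cP _ (cardD _ _ _ si js)).1.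
move=> v vq vs.
have bv := betaP v vq s si vs.
have cv :
  has_value (v 0) (cech_sum c s) (cech_sum (cech_cone (apex v) (beta v)) s).
  apply: has_value_cech_sum => j js; apply: (cP _ (cardD _ _ _ si js)).2 => //.
  exact: on_chart_sub (subD1set s j) vs.
have := has_valueB bv cv; rewrite -{1}(cech_coneP (apex v) (beta v) s).
rewrite addrAC subrr add0r.
rewrite /cech_cone; case: ifP => // js; rewrite beta_cocycle ?mulr0 //.
  by rewrite cardsU1 js si.
apply/forall_inP => l /setU1P[->|ls]; first exact: apexP.
by move/forall_inP: vs; apply.
Qed.

(** Sections with value 1 at one point and 0 at the others exist over each
    chart; the vanishing of the first cohomology of the ideal sheaf glues them
    to a form. *)
Lemma separated_of_cohomology m : (0 < r)%N ->
  cohomology_vanishesS (vanishing_ideal q) m 0 -> forall v0, v0 \in q ->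
  exists2 k : nat, k%:Z = m & separated_by_forms k.
Proof.
move=> r0 H1 v1 v1q.
suff sep v0 : v0 \in q -> exists k (f : R), [/\ k%:Z = m, f \is k.-homog &
    forall v, v \in q -> f.@[v 0] = (v == v0)%:R].
  have [k [_ [km _ _]]] := sep v1 v1q; exists k => // v0 v0q.
  have [k' [f [k'm fk fv]]] := sep v0 v0q.
  move: fk; have -> : k' = k by apply: (can_inj absz_nat); rewrite k'm.
  move=> fk; exists f; split=> // [|w wq /negPf nw]; last by rewrite fv // nw.
  by rewrite fv // eqxx oner_eq0.
move=> v0q.
have /fin_all_exists[b bP] (s : {set 'I_r.+1}) : exists u, s != set0 ->
    twist m s u /\ forall v, v \in q -> on_chart s (v 0) ->
      has_value (v 0) u (v == v0)%:R.
  have [->|s0] := eqVneq s set0; first by exists 0.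
  have [u uT uv] := sections_interpolate m (fun v => (v == v0)%:R) s0.
  by exists u.
have pairD s j : #|s| = 2%N -> j \in s -> s :\ j != set0.
  by move=> + js; rewrite -card_gt0 (cardsD1 j s) js; case: #|s :\ j|.
(* the differential of [b] is a cochain of the ideal sheaf, as the values of [b]
   at one point are equal over all charts *)
have [s s2|s s3|b' b'J bb'] := H1 (cech_sum b).
- apply/twist_vanishingP; split.
    apply: twist_cech_sum => [|j js]; first by rewrite -card_gt0 s2.
    exact: (bP _ (pairD _ _ s2 js)).1.
  move=> v vq vs; rewrite -(cech_sum_const_pair (v == v0)%:R s2).
  apply: has_value_cech_sum => j js; apply: (bP _ (pairD _ _ s2 js)).2 => //.
  exact: on_chart_sub (subD1set s j) vs.
- exact: cech_sum_sum.
pose w s := b s - b' s.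
have set1_n0 (j : 'I_r.+1) : [set j] != set0 by rewrite -card_gt0 cards1.
have w_eq j : w [set j] = w [set ord0].
  have [->//|nj] := eqVneq j ord0; apply: (cech_sum_pair nj).
  rewrite cech_sumB; apply/eqP; rewrite subr_eq0; apply/eqP.
  by rewrite bb' // cards2 nj.
have wT j : twist m [set j] (w [set ord0]).
  rewrite -(w_eq j); apply: twistB; first exact: (bP _ (set1_n0 j)).1.
  by have /twist_vanishingP[] := b'J [set j] (cards1 j).
have [f [k [wf fk fm]]] := twist_glue r0 wT.
have fv v : v \in q -> f.@[v 0] = (v == v0)%:R.
  move=> vq; have [j vj] := coord_neq0 vq.
  have vs : on_chart [set j] (v 0) by apply/forall_inP => l /set1P->.
  have /twist_vanishingP[_ /(_ v vq vs) b'v] := b'J [set j] (cards1 j).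
  have := has_valueB ((bP _ (set1_n0 j)).2 v vq vs) b'v.
  rewrite -/(w [set j]) w_eq wf subr0; apply: has_value_unique.
  exact: has_value_tofrac.
exists k, f; split=> //; case: fm => // f0.
by have /eqP := fv v0 v0q; rewrite f0 meval0 eqxx eq_sym oner_eq0.
Qed.

(** Only the first cohomology needs forms of degree [d]: beyond it, values are
    interpolated over charts of nonempty sets of coordinates. *)
Lemma m_regularP d : (0 < r)%N ->
  m_regular (vanishing_ideal q) d.+1 <-> separated_by_forms d.
Proof.
move=> r0; split=> [reg v vq|sep i].
  have [k km sep] := separated_of_cohomology r0 (reg 0%N) vq.
  have <- : k = d by (move: km; lia).
  exact: sep.
have [ir|ri] := leqP i.+2 r.+1; last first.
  have noset (s : {set 'I_r.+1}) : #|s| <> i.+2.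
    by move=> si; have := max_card s; rewrite card_ord si leqNgt ri.
  move=> a _ _; exists (fun=> 0) => s si; last by case: (noset s).
  apply/twist_vanishingP; split; first by apply: twist0; rewrite -card_gt0 si.
  by move=> v _ _; apply: has_value0.
apply: cohomology_ideal_points => [|s y si]; first by move: ir; lia.
case: i si {ir} => [|i] si; last first.
  by apply: sections_interpolate; rewrite -card_gt0 si.
have [f df fv] := interpolate y sep; exists f%:F.
  apply/twistP; exists 0%N, d, f; split=> //; last by rewrite expr0 divr1.
  by rewrite mul0n addr0; lia.
by move=> v vq _; rewrite -fv //; apply: has_value_tofrac.
Qed.

(** A smaller regularity yields separating forms of smaller degree, which can be
    multiplied by powers of coordinates. *)
Lemma reg_leP d : (0 < r)%N ->
  reg_le (vanishing_ideal q) d.+1 <-> separated_by_forms d.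
Proof.
move=> r0; split=> [[k [reg _] kd] v vq|/(m_regularP d r0) reg].
  have [k' km sep] := separated_of_cohomology r0 (reg 0%N) vq.
  by apply: separated_by_forms_leq sep v vq; move: km kd; lia.
suff [k [reg_k kd kmin]] : exists k, [/\ m_regular (vanishing_ideal q) k,
    (k <= d.+1)%N & forall j, m_regular (vanishing_ideal q) j -> (k <= j)%N].
  by exists k.
elim/ltn_ind: d.+1 reg => e IHe reg.
have [[j [reg_j je]]|nj] := classic (exists j,
    m_regular (vanishing_ideal q) j /\ (j < e)%N).
  have [k [? kj ?]] := IHe j je reg_j.
  by exists k; split=> //; apply: leq_trans (ltnW je).
exists e; split=> // j reg_j; rewrite leqNgt; apply/negP => je; apply: nj.
by exists j.
Qed.

End Points.

(** * Evaluations at the singular points *)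

Lemma mem_sing_points (K : fieldType) (r n : nat) (p : 'I_n -> 'rV[K]_r.+1)
    (F : {mpoly K[r.+1]}) v :
  reflect (exists2 i, in_sing F (p i) & v = p i) (v \in sing_points p F).
Proof.
apply: (iffP mapP) => [[i]|[i iF ->]].
  by rewrite mem_filter => /andP[iF _] ->; exists i.
by exists i; rewrite // mem_filter iF mem_enum.
Qed.

Section Singularities.

Variables (K : fieldType) (r d n : nat) (p : 'I_n -> 'rV[K]_r.+1).
Variable F : {mpoly K[r.+1]}.
Hypothesis p_neq0 : forall i, p i != 0.

Let q := sing_points p F.

(** Two occurrences of one point have proportional evaluations. *)
Lemma sing_evaluations_dependent i j : i != j -> in_sing F (p i) ->
  in_sing F (p j) -> same_point (p i) (p j) -> ~ sing_evaluations_free d p F.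
Proof.
move=> nij iF jF /andP[/sub_rVP[a pij] _] free.
have a0 : a != 0 by apply: contraNneq (p_neq0 i) => a0; rewrite pij a0 scale0r.
pose w (k : 'I_n) : K := if k == i then 1 else if k == j then - a ^+ d else 0.
have wi : w i = 1 by rewrite /w eqxx.
suff : w i = 0 by rewrite wi => /eqP; rewrite oner_eq0.
apply: free => [k|G dG].
  rewrite /w; case: eqP => [->|_]; first by rewrite iF.
  by case: eqP => [->|//]; rewrite jF.
rewrite (bigD1 i) //= (bigD1 j) 1?eq_sym //= big1 ?addr0; last first.
  by move=> k /andP[/negPf ki /negPf kj]; rewrite /w ki kj mul0r.
rewrite wi /w eqxx eq_sym (negPf nij) mul1r.
have -> : G.@[p i 0] = a ^+ d * G.@[p j 0].
  by rewrite -meval_dhomog_scale //; apply: meval_eq => l; rewrite pij mxE.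
by rewrite mulNr subrr.
Qed.

(** The separating forms are a family dual to the evaluations. *)
Lemma sing_evaluations_freeP : uniq q ->
  sing_evaluations_free d p F <-> separated_by_forms q d.
Proof.
move=> uq.
have p_inj i j : in_sing F (p i) -> in_sing F (p j) -> p i = p j -> i = j.
  move=> iF jF pij; pose t := [seq l <- enum 'I_n | in_sing F (p l)].
  have it : i \in t by rewrite mem_filter iF mem_enum.
  have jt : j \in t by rewrite mem_filter jF mem_enum.
  rewrite -(nth_index i it) -(nth_index i jt); congr (nth i t _).
  apply/eqP; rewrite -(nth_uniq (p i) _ _ uq) ?size_map ?index_mem //.
  by rewrite !(nth_map i) ?index_mem // !nth_index // pij.
split=> [free v /mem_sing_points[i0 i0F ->]|sep w w0 wG i]; last first.
  have [iF|/w0//] := boolP (in_sing F (p i)).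
  have [|G [dG Gi Gj]] := sep (p i); first by apply/mem_sing_points; exists i.
  have /eqP := wG G dG; rewrite (bigD1 i) //= big1 ?addr0 => [|j nj].
    by rewrite mulf_eq0 (negPf Gi) orbF => /eqP.
  have [jF|/w0->] := boolP (in_sing F (p j)); last by rewrite mul0r.
  rewrite Gj ?mulr0 //; first by apply/mem_sing_points; exists j.
  by apply: contraNneq nj => /p_inj->.
pose I := [set i | in_sing F (p i)].
pose M : 'M[K]_(#|I|, 'C(r + d, d)) :=
  \matrix_(k, a) ('X_[monomial a] : {mpoly K[r.+1]}).@[p (enum_val k) 0].
have Mfree : row_free M.
  apply: inj_row_free => y yM.
  pose w i := \sum_(k | enum_val k == i) y 0 k.
  have wE k : w (enum_val k) = y 0 k.
    by rewrite /w (big_pred1 k) // => l; rewrite (inj_eq enum_val_inj).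
  have w0 i : ~~ in_sing F (p i) -> w i = 0.
    move=> iF; rewrite /w big_pred0 // => k; apply: contraNF iF => /eqP <-.
    by have := enum_valP k; rewrite inE.
  apply/rowP => k; rewrite mxE -wE; apply: free => // G dG.
  rewrite (bigID (mem I)) /= [X in _ + X]big1 ?addr0 => [|i]; last first.
    by rewrite inE => /w0->; rewrite mul0r.
  rewrite big_enum_val /=; under eq_bigr do rewrite wE.
  rewrite (dhomog_sum_monomials dG).
  under eq_bigr do rewrite (raddf_sum (meval _)) mulr_sumr.
  rewrite exchange_big big1 //= => a _.
  have /rowP/(_ a) := yM; rewrite !mxE => e.
  rewrite -[RHS](mulr0 G@_(monomial a)) -{}[in RHS]e mulr_sumr.
  by apply: eq_bigr => l _; rewrite mevalZ mxE mulrCA.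
have [B MB] := row_freeP Mfree.
have Ii0 : i0 \in I by rewrite inE.
pose k0 := enum_rank_in Ii0 i0.
pose u a := B a k0.
have uE i : i \in I -> (form_of u).@[p i 0] = (i == i0)%:R.
  move=> Ii; have /matrixP/(_ (enum_rank_in Ii0 i) k0) := MB; rewrite !mxE.
  rewrite -(inj_eq enum_val_inj) !enum_rankK_in // => <-.
  rewrite /form_of (raddf_sum (meval _)); apply: eq_bigr => a _ /=.
  by rewrite mevalZ mxE enum_rankK_in // mulrC.
exists (form_of u); split; first exact: form_of_dhomog.
  by rewrite uE // eqxx oner_eq0.
move=> w /mem_sing_points[i iF ->] nw; rewrite uE ?inE //.
by have [e|//] := eqVneq i i0; rewrite e eqxx in nw.
Qed.

End Singularities.

Theorem theorem2 (K : fieldType) (r d n : nat)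
  (r_ge2 : (2 <= r)%N) (d_ge2 : (2 <= d)%N) (n_ge : ('C(r + d, d) <= n)%N)
  (p : 'I_n -> 'rV[K]_r.+1) (p_neq0 : forall i, p i != 0) (pX : in_X d p)
  (F : {mpoly K[r.+1]}) (pF : on_unique_hypersurface d p F) :
  let q := sing_points p F in
  ((exists i j : nat, (i < j < size q)%N /\ same_point q`_i q`_j) ->
     singular_point_X d p) /\
  ((forall i j : nat, (i < j < size q)%N -> ~~ same_point q`_i q`_j) ->
     [/\ smooth_point_X d p <-> d_normal (vanishing_ideal q) d,
         smooth_point_X d p <-> m_regular (vanishing_ideal q) d.+1
       & smooth_point_X d p <-> reg_le (vanishing_ideal q) d.+1]).
Proof.
move=> q; have smoothP := smooth_point_XP n_ge p_neq0 pF.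
split=> [[i [j [/andP[ij jq] pij]]]|distinct].
  split=> // /smoothP.
  pose t := [seq i <- enum 'I_n | in_sing F (p i)].
  have qt : q = map p t by [].
  have jt : (j < size t)%N by rewrite -(size_map p) -qt.
  have [n0 _] : exists k, k \in t.
    by case: (t) jt => // k t' _; exists k; apply: mem_head.
  have it := ltn_trans ij jt.
  have inF k : (k < size t)%N -> in_sing F (p (nth n0 t k)).
    by move=> /(mem_nth n0); rewrite mem_filter => /andP[].
  apply: (sing_evaluations_dependent p_neq0
    (i := nth n0 t i) (j := nth n0 t j)).
  - by rewrite (nth_uniq n0 it jt) ?neq_ltn ?ij // filter_uniq // enum_uniq.
  - exact: inF.
  - exact: inF.
  by rewrite -!(nth_map n0 0) // -qt.
have q0 v : v \in q -> v != 0 by move=> /mem_sing_points[i _ ->].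
have uq : uniq q.
  apply/(uniqP 0) => i j; rewrite !inE.
  wlog ij : i j / (i < j)%N => [W iq jq e|_ jq e].
    by case: (ltngtP i j) => // ij; [apply: W | apply/esym/W].
  by have := distinct i j; rewrite ij jq e /same_point submx_refl => /(_ isT).
have qd : {in q &, forall v w, v != w -> ~~ same_point v w}.
  move=> v w vq wq.
  rewrite -{1 2}(nth_index 0 vq) -{1 2}(nth_index 0 wq) => nvw.
  have [lt_vw|lt_wv|e] := ltngtP (index v q) (index w q).
  - by apply: distinct; rewrite lt_vw index_mem.
  - by rewrite /same_point andbC; apply: distinct; rewrite lt_wv index_mem.
  - by rewrite e eqxx in nvw.
have sepP := sing_evaluations_freeP d uq.
have r0 : (0 < r)%N by apply: leq_trans r_ge2.
split; rewrite smoothP sepP.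
- by split=> /(d_normalP q0 qd).
- by split=> /(m_regularP q0 qd d r0).
by split=> /(reg_leP q0 qd d r0).
Qed.
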